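(* Let $E\subset\mathbb{R}$ be a finite union of disjoint closed bounded intervals, and let $\mu$ be a measure on $\mathbb{R}$ of compact support with $\sigma_{\mathrm{ess}}(\mu)=E$. Suppose that for every $\eta>0$, $$\lim_{m\to\infty}\Bigl|\bigl\{x\in E:\ \mu([x-\tfrac1m,x+\tfrac1m])\le e^{-m\eta}\bigr\}\Bigr|=0,$$ where $|\cdot|$ is Lebesgue measure. Then $\mu$ is regular. *)

(* Defs.v *)
From HB Require Import structures.
From mathcomp Require Import all_boot all_order all_algebra.
From mathcomp Require Import all_classical all_reals all_analysis.
Set Implicit Arguments. Unset Strict Implicit. Unset Printing Implicit Defensive.
Import Order.TTheory GRing.Theory Num.Theory.
Import numFieldNormedType.Exports.
Local Open Scope classical_set_scope.
Local Open Scope ring_scope.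

Section Defs.
Variable R : realType.
Notation RT := (measurableTypeR R).

Definition msupp (mu : set RT -> \bar R) : set R :=
  [set x : R | forall e : R, 0 < e -> (0 < mu [set y : R | (x - e < y < x + e)%R])%E].

Definition ess_supp (mu : set RT -> \bar R) : set R :=
  [set x | msupp mu x /\
     forall e : R, 0 < e -> exists y, msupp mu y /\ y != x /\ `|y - x| < e].

Definition logkernel (x y : R) : \bar R :=
  if x == y then +oo%E else (- ln `|x - y|)%:E.

Definition log_energy (nu : set RT -> \bar R) : \bar R :=
  \int[nu]_x \int[nu]_y logkernel x y.

Definition prob_on (K : set R) (nu : {measure set RT -> \bar R}) : Prop :=
  nu setT = 1%E /\ nu (~` K) = 0%E.

(** logarithmic capacity cap(K) = exp(- inf { I(nu) : nu probability measure on K }),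
    with cap(K) = 0 when the infimum is +oo (e.g. K polar or empty) *)
Definition log_capacity (K : set R) : R :=
  let V := ereal_inf [set log_energy nu | nu in prob_on K] in
  match V with
  | r%:E => expR (- r)
  | _ => 0
  end.

Definition monic_deg (n : nat) : set {poly R} :=
  [set P | P \is monic /\ size P = n.+1].

(** minimal L^2(mu)-norm of monic polynomials of degree n,
    i.e. the norm 1/gamma_n of the n-th monic orthogonal polynomial *)
Definition min_monic_L2 (mu : {measure set RT -> \bar R}) (n : nat) : R :=
  Num.sqrt (fine (ereal_inf
    [set (\int[mu]_x ((`|P.[x]| ^+ 2)%R)%:E)%E | P in monic_deg n])).

(** Stahl--Totik regularity: lim gamma_n^{-1/n} = cap(supp mu) *)
Definition regular_measure (mu : {measure set RT -> \bar R}) : Prop :=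
  (fun n : nat => powR (min_monic_L2 mu n) (n%:R^-1)) @ \oo
    --> log_capacity (msupp mu).

End Defs.

(* Main.v *)
Require Import Defs.
From HB Require Import structures.
From mathcomp Require Import all_boot all_order all_algebra.
From mathcomp Require Import all_classical all_reals all_analysis.
From mathcomp Require Import measurable_realfun complex ring lra.
Import Order.TTheory GRing.Theory Num.Theory.
Import numFieldNormedType.Exports.
Local Open Scope classical_set_scope.
Local Open Scope ring_scope.
Set Implicit Arguments. Unset Strict Implicit. Unset Printing Implicit Defensive.

(* Let K be the support of mu, contained in [-D, D], and V the least logarithmic
   energy on K.  The kernel [- ln |x - y|] is regularized to [- ln (|x - y| + r)],
   which is bounded, Lipschitz and convex on either side of the diagonal.  Take n
   points of K nearly minimizing the regularized energy.  Moving one point shows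
   that their potential is, up to O(1), at least as large on K as at the points
   themselves; by convexity between the points it is nowhere larger than its
   maximum over them; and drawing points independently from a measure of energy
   close to V bounds their energy above by about n^2 V.  Smearing each point over
   a short interval of E (the few points that are not close to E do not matter)
   gives a probability measure w on E, with bounded density, whose potential is
   at most V + eps.  Hence the potential of the points divided by n is about V
   on K.
   The monic polynomials with these roots give the upper bound for the monic L^2
   minima.  Conversely, a monic P can be assumed to have its n roots in [-D, D].
   If its L^2 norm were much smaller than exp(- n V), then |P| would be at most
   exp(- n (V + 4 eps)) at all points of E whose 1/m-neighbourhoods (m = n L) are
   not thin for mu and which are not within T/m of a root, that is, outside a set
   of small Lebesgue measure; integrating - ln |P| against w contradicts the bound
   on the potential of w. *)

(** * Regularized kernel and near-minimizing configurations *)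

Section Kernel.
Context {R : realType}.
Implicit Types (r x y z D : R) (s : seq R).

Lemma ler_sum_seq (I : eqType) (t : seq I) (F G : I -> R) :
  (forall i, i \in t -> F i <= G i) -> \sum_(i <- t) F i <= \sum_(i <- t) G i.
Proof. by move=> FG; rewrite big_seq [leRHS]big_seq ler_sum. Qed.

Lemma sumr_const_seq (I : Type) (t : seq I) (c : R) : \sum_(i <- t) c = (size t)%:R * c.
Proof. by rewrite big_const_seq count_predT iter_addr_0 mulr_natl. Qed.

Definition rkernel r x : R := - ln (`|x| + r).

Definition rpotential r s z : R := \sum_(x <- s) rkernel r (z - x).

(** The diagonal is included: each point meets itself with weight [rkernel r 0 = - ln r], which adds
    only a term linear in the number of points. *)
Definition renergy r s : R := \sum_(x <- s) rpotential r s x.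

Lemma rkernelN r x : rkernel r (- x) = rkernel r x.
Proof. by rewrite /rkernel normrN. Qed.

Lemma rkernelB r x y : rkernel r (x - y) = rkernel r (y - x).
Proof. by rewrite -rkernelN opprB. Qed.

Lemma ln_le_subr1 x : 0 < x -> ln x <= x - 1.
Proof.
move=> x0; have := @le_ln1Dx R (x - 1); rewrite subrKC; apply.
by rewrite ltrBrDr addNr.
Qed.

Lemma ler_rkernel r x y : 0 < r -> `|x| <= `|y| -> rkernel r y <= rkernel r x.
Proof.
move=> r0 xy; rewrite /rkernel lerN2 ler_ln ?posrE ?ltr_wpDl//.
by rewrite lerD2r.
Qed.

Lemma rkernel0 r : rkernel r 0 = - ln r.
Proof. by rewrite /rkernel normr0 add0r. Qed.

Lemma rkernel_le r x : 0 < r -> rkernel r x <= - ln r.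
Proof. by move=> r0; rewrite -rkernel0 ler_rkernel// normr0. Qed.

Lemma rkernel_ge D r x : 0 < r -> r <= 1 -> `|x| <= 2 * D ->
  - ln (2 * D + 1) <= rkernel r x.
Proof.
move=> r0 r1 xD; rewrite /rkernel lerN2 ler_ln ?posrE ?ltr_wpDl//; first lra.
by have := normr_ge0 x; lra.
Qed.

(** Apply [ln u <= u - 1] to the ratio of [|y| + r] and [|x| + r]; the denominator is at least
    [r]. *)
Lemma rkernel_lipschitz r x y : 0 < r ->
  rkernel r x <= rkernel r y + `|x - y| / r.
Proof.
move=> r0; have x0 : 0 < `|x| + r by rewrite ltr_wpDl.
have y0 : 0 < `|y| + r by rewrite ltr_wpDl.
suff : ln (`|y| + r) - ln (`|x| + r) <= `|x - y| / r by rewrite /rkernel; lra.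
rewrite -ln_div ?posrE//.
apply: (le_trans (ln_le_subr1 (divr_gt0 y0 x0))).
rewrite -(@divff _ (`|x| + r)) ?gt_eqF// -mulrBl.
have yx : `|y| + r - (`|x| + r) <= `|x - y|.
  by have := lerB_dist y x; rewrite (distrC y x); lra.
rewrite (le_trans (ler_wpM2r _ yx)) ?invr_ge0 ?(ltW x0)//.
by rewrite ler_wpM2l// lef_pV2 ?posrE//; have := normr_ge0 x; lra.
Qed.

Lemma rkernel_continuous r : 0 < r -> continuous (rkernel r).
Proof.
move=> r0 x; apply: cvgN; apply: continuous_cvg.
  by apply: continuous_ln; rewrite ltr_wpDl.
by apply: cvgD; [apply: cvg_norm; exact: cvg_id|exact: cvg_cst].
Qed.

(* [t |-> - ln t] lies above its tangent line at any point. *)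
Lemma rkernel_convex r p q z x : 0 < r -> p <= z -> z <= q -> (x <= p) || (q <= x) ->
  (q - p) * rkernel r (z - x) <=
  (q - z) * rkernel r (p - x) + (z - p) * rkernel r (q - x).
Proof.
move=> r0 pz zq.
suff H (a b c : R) : 0 < a -> 0 < b -> 0 < c ->
    (q - p) * c = (q - z) * a + (z - p) * b ->
    (q - p) * - ln c <= (q - z) * - ln a + (z - p) * - ln b.
  (* As [x] is not strictly between [p] and [q], the three absolute values open with the same sign,
     so the arguments of [ln] are affine in the point. *)
  move=> xpq; rewrite /rkernel; apply: H; rewrite ?ltr_wpDl//.
  by case/orP: xpq => xpq; [rewrite !ger0_norm ?subr_ge0|
    rewrite !ler0_norm ?subr_le0]; first [ring|lra].
move=> a0 b0 c0 E.
have Ha : ln a <= ln c + (a / c - 1).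
  by rewrite -lerBlDl -ln_div ?posrE// ln_le_subr1 ?divr_gt0.
have Hb : ln b <= ln c + (b / c - 1).
  by rewrite -lerBlDl -ln_div ?posrE// ln_le_subr1 ?divr_gt0.
have qz0 : 0 <= q - z by lra.
have zp0 : 0 <= z - p by lra.
have := ler_wpM2l qz0 Ha; have := ler_wpM2l zp0 Hb.
have E2 : (q - z) * (a / c) + (z - p) * (b / c) = q - p.
  by rewrite !mulrA -mulrDl -E mulfK ?gt_eqF.
lra.
Qed.

Lemma seq_max_le (s : seq R) z : has (fun x => x <= z) s ->
  exists2 p, p \in s /\ p <= z & forall x, x \in s -> x <= z -> x <= p.
Proof.
elim: s => //= y s IH; case: (boolP (has (fun x => x <= z) s)) => [/IH|hs].
  case=> p [ps pz] pmax _; case: (boolP ((p <= y) && (y <= z))) => [/andP[py yz]|nyz].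
    exists y; first by rewrite mem_head.
    move=> x; rewrite inE => /orP[/eqP->//|xs xz].
    exact: le_trans (pmax _ xs xz) py.
  exists p; first by rewrite inE ps orbT.
  move=> x; rewrite inE => /orP[/eqP-> yz|]; last exact: pmax.
  by move: nyz; rewrite yz andbT -ltNge => /ltW.
rewrite orbF => yz; exists y; first by rewrite mem_head.
move=> x; rewrite inE => /orP[/eqP->//|xs xz].
by case/negP: hs; apply/hasP; exists x.
Qed.

Lemma seq_min_ge (s : seq R) z : has (fun x => z <= x) s ->
  exists2 q, q \in s /\ z <= q & forall x, x \in s -> z <= x -> q <= x.
Proof.
move=> hs; have [|p [ps pz] pmax] := @seq_max_le (map -%R s) (- z).
  by apply/hasP; case/hasP: hs => x xs zx; exists (- x); rewrite ?map_f// lerN2.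
exists (- p).
  split; last by rewrite lerNr.
  by case/mapP: ps => x xs ->; rewrite opprK.
by move=> x xs zx; rewrite lerNl; apply: pmax; rewrite ?map_f// lerN2.
Qed.

(* The potential is convex on each gap of the points and monotone outside
   their convex hull. *)
Lemma maximum_principle r s z : 0 < r -> s != [::] ->
  exists2 x, x \in s & rpotential r s z <= rpotential r s x.
Proof.
move=> r0 s0.
have hs : has predT s by case: s s0.
case: (boolP (has (fun x => x <= z) s)) => [hle|nle]; last first.
  have [q [qs zq] qmin] : exists2 q, q \in s /\ z <= q &
      forall x, x \in s -> z <= x -> q <= x.
    apply: seq_min_ge; case/hasP: hs => x xs _; apply/hasP; exists x => //.
    by rewrite ltW// ltNge; apply: contra nle => xz; apply/hasP; exists x.
  exists q => //; apply: ler_sum_seq => x xs; apply: ler_rkernel => //.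
  have zx : z <= x.
    by rewrite ltW// ltNge; apply: contra nle => xz; apply/hasP; exists x.
  have qx := qmin _ xs zx.
  by rewrite !ler0_norm ?subr_le0//; lra.
have [p [ps pz] pmax] := seq_max_le hle.
case: (boolP (has (fun x => z <= x) s)) => [hge|nge]; last first.
  exists p => //; apply: ler_sum_seq => x xs; apply: ler_rkernel => //.
  have xz : x <= z.
    by rewrite ltW// ltNge; apply: contra nge => xz; apply/hasP; exists x.
  have px := pmax _ xs xz.
  by rewrite !ger0_norm ?subr_ge0//; lra.
have [q [qs zq] qmin] := seq_min_ge hge.
(* Since [p <= z <= q], the case [q <= p] means that [z] is itself a point of [s]. *)
have [pq|qp] := ltP p q; last by exists p => //; have -> : z = p by lra.
have H : (q - p) * rpotential r s z <=
    (q - z) * rpotential r s p + (z - p) * rpotential r s q.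
  rewrite /rpotential !mulr_sumr -big_split; apply: ler_sum_seq => x xs.
  apply: rkernel_convex => //; have [xz|zx] := leP x z; first by rewrite pmax.
  by rewrite qmin ?orbT// ltW.
have [le_qp|lt_pq] := leP (rpotential r s q) (rpotential r s p).
  exists p => //; rewrite -(ler_pM2l (x := q - p)) ?subr_gt0//.
  apply: (le_trans H); have : (z - p) * rpotential r s q <= (z - p) * rpotential r s p.
    by rewrite ler_wpM2l// subr_ge0.
  lra.
exists q => //; rewrite -(ler_pM2l (x := q - p)) ?subr_gt0//.
apply: (le_trans H); have : (q - z) * rpotential r s p <= (q - z) * rpotential r s q.
  by rewrite ler_wpM2l ?subr_ge0// ltW.
lra.
Qed.

Lemma perm_rpotential r s s' z : perm_eq s s' -> rpotential r s z = rpotential r s' z.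
Proof. by move=> ss'; apply: perm_big. Qed.

Lemma perm_renergy r s s' : perm_eq s s' -> renergy r s = renergy r s'.
Proof.
move=> ss'; rewrite /renergy (perm_big _ ss')/=.
by apply: eq_bigr => x _; exact: perm_rpotential.
Qed.

Lemma rpotential_cons r s x z :
  rpotential r (x :: s) z = rkernel r (z - x) + rpotential r s z.
Proof. by rewrite /rpotential big_cons. Qed.

Lemma renergy_cons r s x :
  renergy r (x :: s) = rkernel r 0 + 2 * rpotential r s x + renergy r s.
Proof.
rewrite /renergy big_cons rpotential_cons subrr.
under eq_bigr do rewrite rpotential_cons.
rewrite big_split/=.
have -> : \sum_(i <- s) rkernel r (i - x) = rpotential r s x.
  by apply: eq_bigr => y _; exact: rkernelB.
by ring.
Qed.

Lemma rpotential_lb D r s z : 0 < r -> r <= 1 ->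
  (forall x, x \in s -> `|z - x| <= 2 * D) ->
  - ((size s)%:R * ln (2 * D + 1)) <= rpotential r s z.
Proof.
move=> r0 r1 sD; rewrite /rpotential -mulrN -sumr_const_seq.
apply: ler_sum_seq => x xs; exact: rkernel_ge (sD _ xs).
Qed.

Lemma renergy_lb D r s : 0 < r -> r <= 1 ->
  (forall x y, x \in s -> y \in s -> `|x - y| <= 2 * D) ->
  - ((size s)%:R ^+ 2 * ln (2 * D + 1)) <= renergy r s.
Proof.
move=> r0 r1 sD; rewrite /renergy expr2 -mulrA -mulrN.
rewrite -(sumr_const_seq s (- _)).
apply: ler_sum_seq => x xs; apply: (@rpotential_lb D) => // y ys; exact: sD.
Qed.

(* Near-minimality is stable under moving a single point, which costs only
   the diagonal term. *)
Lemma exists_near_minimizer D r (K : set R) n : 0 < r -> r <= 1 ->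
  (forall x y, K x -> K y -> `|x - y| <= 2 * D) -> K !=set0 ->
  exists s, [/\ size s = n, (forall x, x \in s -> K x),
    (forall s', size s' = n -> (forall x, x \in s' -> K x) ->
      renergy r s <= renergy r s' + 1) &
    (forall g x, K g -> x \in s -> rpotential r s x <=
      rpotential r s g + (1 - ln r + ln (2 * D + 1)))].
Proof.
move=> r0 r1 KD [k0 Kk0].
pose A := [set renergy r s | s in [set s | size s = n /\ forall x, x \in s -> K x]].
have infA : has_inf A.
  split.
    exists (renergy r (nseq n k0)), (nseq n k0) => //; split; first exact: size_nseq.
    by move=> x /nseqP[->].
  exists (- (n%:R ^+ 2 * ln (2 * D + 1))) => _ [s [sn sK] <-].
  by rewrite -sn; apply: renergy_lb => // x y xs ys; apply: KD; exact: sK.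
have [_ [s [sn sK] <-] sinf] := inf_adherent ltr01 infA.
have smin s' : size s' = n -> (forall x, x \in s' -> K x) -> renergy r s <= renergy r s' + 1.
  move=> s'n s'K; apply: (le_trans (ltW sinf)); rewrite lerD2r.
  by apply: ge_inf; [exact: infA.2|exists s'].
exists s; split => // g x Kg xs.
(* Replace [x] by [g]: the energy of the remainder [t] cancels, which compares the potentials of [t]
   at [x] and at [g]. Restoring [x] adds [- ln r] on the left and at least [- ln (2 * D + 1)] on the
   right. *)
have perm := perm_to_rem xs; set t := rem x s in perm.
have tK y : y \in t -> K y by move=> yt; apply: sK; rewrite (perm_mem perm) inE yt orbT.
have sz : size (g :: t) = n by rewrite -sn (perm_size perm).
have gtK y : y \in g :: t -> K y by rewrite inE => /orP[/eqP->//|/tK].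
have := smin _ sz gtK; rewrite (perm_renergy _ perm) !renergy_cons => H.
rewrite !(perm_rpotential _ _ perm) !rpotential_cons subrr.
have := @rkernel_ge D r (g - x) r0 r1 (KD _ _ Kg (sK _ xs)).
rewrite rkernel0 in H *; lra.
Qed.

End Kernel.

(** * Comparison with the energy of measures *)

Section Integral.

(** The integral is a difference of suprema over simple functions below the positive and negative
    parts, so it is monotone for arbitrary functions. This allows comparison with the iterated
    integral in [log_energy], whose inner integral is not shown to be measurable. *)
Lemma le_integral_pointwise d (T : measurableType d) (R : realType)
    (nu : {measure set T -> \bar R}) (f g : T -> \bar R) :
  (forall x, f x <= g x)%E -> (\int[nu]_x f x <= \int[nu]_x g x)%E.
Proof.
move=> fg; rewrite /integral !patch_setT.
apply: leeB; apply: le_ereal_sup => _ [h /= hf <-]; exists h => //= x;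
  apply: (le_trans (hf x)).
  by rewrite !funeposE ge_max !le_max lexx fg !orbT.
by rewrite !funenegE ge_max !le_max lexx leeN2 fg !orbT.
Qed.

Context {R : realType}.
Notation RT := (measurableTypeR R).
Variables (nu : {measure set RT -> \bar R}) (K : set R).
Hypotheses (cK : compact K) (nuT : nu setT = 1%E) (nuK : nu (~` K) = 0%E).

Lemma compact_measurableR : measurable (K : set RT).
Proof. exact: compact_measurable. Qed.
Let mK := compact_measurableR.

Lemma prob_on_measure : nu K = 1%E.
Proof.
have : nu (K `|` ~` K) = (nu K + nu (~` K))%E.
  by apply: measureU => //; [exact: measurableC|exact: setICr].
by rewrite setUv nuK adde0 nuT.
Qed.

Lemma continuous_integrableT (f : R -> R) : continuous f ->
  nu.-integrable setT (EFin \o f).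
Proof.
move=> cf; have mf : measurable_fun setT (f : RT -> RT) by exact: continuous_measurable_fun.
have mEf : measurable_fun setT (EFin \o (f : RT -> R)) by exact/measurable_EFinP.
apply/(negligible_integrable (measurableC mK) measurableT mEf nuK).
rewrite setDE setTI setCK; apply: measurable_bounded_integrable => //.
- by rewrite prob_on_measure ltry.
- exact: measurable_funTS.
- have /compact_bounded [M [Mr HM]] : compact (f @` K).
    by apply: continuous_compact => //; exact: continuous_subspaceT.
  exists M; split => // N MN x Kx; exact: HM.
Qed.

Lemma continuous_integrable (f : R -> R) : continuous f ->
  nu.-integrable K (EFin \o f).
Proof. by move=> cf; apply: integrableS (continuous_integrableT cf). Qed.

Lemma integralT_on (f : R -> R) : continuous f ->
  (\int[nu]_x (f x)%:E = (\int[nu]_(x in K) f x)%R%:E)%E.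
Proof.
move=> cf; have i := continuous_integrableT cf.
have := negligible_integral (measurableC mK) measurableT i nuK.
rewrite /= => ->; rewrite setDE setTI setCK /Rintegral fineK//.
exact: integrable_fin_num (continuous_integrable cf).
Qed.

(** With the slack [1], weak monotonicity of the integral already yields the contradiction
    [a + 1 <= a]. *)
Lemma exists_le_mean (f : R -> R) : continuous f ->
  exists2 y, K y & f y <= \int[nu]_(x in K) f x + 1.
Proof.
move=> cf; set a := Rintegral _ _ _; apply: contrapT => H.
suff : a + 1 <= a by rewrite gerDl ler10.
have -> : a + 1 = \int[nu]_(x in K) (cst (a + 1)) x.
  by rewrite Rintegral_cst// prob_on_measure mulr1.
apply: le_Rintegral => //.
- by apply: continuous_integrable => x; exact: cvg_cst.
- exact: continuous_integrable.
- by move=> x Kx /=; rewrite leNgt; apply/negP => /ltW fx; apply: H; exists x.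
Qed.

Lemma mean_ge (f : R -> R) c : continuous f -> (forall x, K x -> c <= f x) ->
  c <= \int[nu]_(x in K) f x.
Proof.
move=> cf cle; have -> : c = \int[nu]_(x in K) (cst c) x.
  by rewrite Rintegral_cst// prob_on_measure mulr1.
apply: le_Rintegral => //.
- by apply: continuous_integrable => x; exact: cvg_cst.
- exact: continuous_integrable.
Qed.

Section Kernel.
Variable r : R.
Hypothesis r0 : 0 < r.

Definition kpotential (x : R) : R := \int[nu]_(y in K) rkernel r (x - y).

Definition kenergy : R := \int[nu]_(x in K) kpotential x.

Lemma rkernel_shift_continuous (x : R) : continuous (fun y => rkernel r (x - y)).
Proof.
move=> y; apply: (@continuous_comp _ _ _ (fun y => x - y) (rkernel r)).
  by apply: cvgB; [exact: cvg_cst|exact: cvg_id].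
exact: rkernel_continuous.
Qed.

(** The potential inherits the Lipschitz constant [1 / r] of the kernel because [nu] has mass one on
    [K]. *)
Lemma kpotential_continuous : continuous kpotential.
Proof.
have lip x x' : kpotential x <= kpotential x' + `|x - x'| / r.
  have -> : `|x - x'| / r = \int[nu]_(y in K) (cst (`|x - x'| / r)) y.
    by rewrite Rintegral_cst// prob_on_measure mulr1.
  rewrite -RintegralD//; last 2 first.
    - exact: continuous_integrable (@rkernel_shift_continuous x').
    - by apply: continuous_integrable => z; exact: cvg_cst.
  apply: le_Rintegral => //.
  - exact: continuous_integrable (@rkernel_shift_continuous x).
  - apply: (@continuous_integrable (fun y => rkernel r (x' - y) + `|x - x'| / r)) => z.
    by apply: cvgD; [exact: rkernel_shift_continuous|exact: cvg_cst].
  - move=> y _ /=; have := rkernel_lipschitz (x - y) (x' - y) r0.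
    by rewrite (_ : x - y - (x' - y) = x - x')//; ring.
move=> x; apply/cvgrPdist_lt => e e0.
near=> y.
have xy : `|x - y| < e * r.
  by near: y; apply: cvgr_dist_lt; [exact: cvg_id|rewrite mulr_gt0].
have {}xy : `|x - y| / r < e by rewrite ltr_pdivrMr.
have := lip x y; have := lip y x; rewrite (distrC y x) => h1 h2.
by rewrite ltr_norml; apply/andP; split; lra.
Unshelve. all: by end_near. Qed.

(** Adding [r] inside the logarithm only lowers the kernel. *)
Lemma kenergy_le_log_energy : (kenergy%:E <= log_energy nu)%E.
Proof.
rewrite /kenergy -(integralT_on kpotential_continuous).
apply: le_integral_pointwise => x.
rewrite -(integralT_on (@rkernel_shift_continuous x)).
apply: le_integral_pointwise => y; rewrite /logkernel.
case: eqVneq => [_|xy]; first exact: leey.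
have xy0 : 0 < `|x - y| by rewrite normr_gt0 subr_eq0.
by rewrite lee_fin lerN2 ler_ln ?posrE ?addr_gt0// lerDl ltW.
Qed.

(* First-moment method: points drawn independently from [nu] have expected
   off-diagonal energy [m (m - 1) kenergy]; the external field [f] carries the
   interaction with the points already drawn. *)
Lemma exists_energy_le_mean m (f : R -> R) : continuous f ->
  exists s, [/\ size s = m, (forall x, x \in s -> K x) &
    renergy r s + 2 * \sum_(x <- s) f x <=
    m%:R ^+ 2 * kenergy + m%:R * (2 - ln r - kenergy) +
    2 * m%:R * \int[nu]_(x in K) f x].
Proof.
elim: m f => [|m IH] f cf.
  by exists [::]; split => //; rewrite /renergy !big_nil; lra.
(* The first point [y] is chosen in [f] plus its expected interaction with the [m] points still to
   be drawn. *)
have cg : continuous (fun y => f y + m%:R * kpotential y).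
  move=> y; apply: cvgD; first exact: cf.
  by apply: cvgM; [exact: cvg_cst|exact: kpotential_continuous].
have [y Ky] := exists_le_mean cg.
have cmk : continuous (fun y => m%:R * kpotential y).
  by move=> z; apply: cvgM; [exact: cvg_cst|exact: kpotential_continuous].
rewrite RintegralD//; last 2 first.
  - exact: continuous_integrable.
  - exact: continuous_integrable.
rewrite RintegralZl//; last exact: continuous_integrable kpotential_continuous.
rewrite -/kenergy => Hy.
(* Once [y] is fixed, the other points are drawn in the field [f] augmented by the kernel of [y]. *)
have ch : continuous (fun x => f x + rkernel r (y - x)).
  by move=> z; apply: cvgD; [exact: cf|exact: rkernel_shift_continuous].
have [s [sm sK Hs]] := IH _ ch.
exists (y :: s); split; first by rewrite /= sm.
  by move=> x; rewrite inE => /orP[/eqP->|/sK].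
move: Hs; rewrite renergy_cons !big_cons rkernel0 big_split/=.
rewrite RintegralD//; last 2 first.
  - exact: continuous_integrable.
  - exact: continuous_integrable (@rkernel_shift_continuous y).
rewrite -/(kpotential y) -/(rpotential r s y) -natr1.
lra.
Qed.

End Kernel.
End Integral.

(** * Potentials of smeared point masses *)

Section NearEstimate.
Context {R : realType}.
Notation RT := (measurableTypeR R).
Notation leb := (@lebesgue_measure R).
Implicit Types (C z y rho : R).

Lemma lebesgue_measure_cc (a b : R) : a <= b -> leb `[a, b]%classic = (b - a)%:E.
Proof.
rewrite lebesgue_measure_itv/= lte_fin -EFinD; case: ltgtP => // -> _.
by rewrite subrr.
Qed.

(* The logarithmic kernel shifted by [C] and truncated below at [0]: for
   [C = ln (2 D + 1)] it is [logkernel + C] on [-D, D], and being nonnegative it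
   can be integrated without any integrability assumption. *)
Definition pkernel C z y : \bar R := maxe 0%E (logkernel z y + C%:E)%E.

Lemma pkernel_ge0 C z y : (0 <= pkernel C z y)%E.
Proof. by rewrite le_max lexx. Qed.

Lemma logkernel_le_pkernel C z y : (logkernel z y <= pkernel C z y - C%:E)%E.
Proof. by rewrite leeBrDr// le_max lexx orbT. Qed.

Lemma measurable_logkernel z : measurable_fun setT (logkernel z : RT -> \bar R).
Proof.
apply: measurable_fun_ifT => /=.
- apply: (measurable_fun_bool true).
  rewrite setTI (_ : _ @^-1` _ = [set z]); first exact: measurable_set1.
  by apply/seteqP; split => y /=; rewrite eq_sym => /eqP.
- exact: measurable_cst.
- apply/measurable_EFinP; apply: measurableT_comp => //.
  apply: (measurableT_comp (@measurable_ln R)).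
  apply: (measurableT_comp (@normr_measurable R setT)).
  exact: measurable_funB.
Qed.

Lemma measurable_pkernel C z : measurable_fun setT (pkernel C z : RT -> \bar R).
Proof.
apply: measurable_maxe; first exact: measurable_cst.
by apply: emeasurable_funD; [exact: measurable_logkernel|exact: measurable_cst].
Qed.

Lemma ln2_le1 : ln 2 <= 1 :> R.
Proof. by have := @ln_le_subr1 R 2; rewrite (_ : 2 - 1 = 1); [apply|ring]. Qed.

Let ball2 z rho (k : nat) : set R := `[z - rho / 2 ^+ k, z + rho / 2 ^+ k]%classic.

Let in_ball2 z rho k y : ball2 z rho k y <-> `|z - y| <= rho / 2 ^+ k.
Proof.
rewrite /ball2/= in_itv/= ler_norml; split => /andP[h1 h2];
  by apply/andP; split; lra.
Qed.

(* Counting dyadic scales: [ln (rho / t)] is at most the number of [k] with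
   [t <= rho / 2 ^ k], up to the contribution of the scales below [rho / 2 ^ n]. *)
Lemma ln_le_dyadic_count rho z y n : 0 < rho -> 0 < `|z - y| ->
  ln (rho / `|z - y|) <=
  \sum_(k < n) \1_(ball2 z rho k) y + Num.max 0 (ln (rho / 2 ^+ n / `|z - y|)).
Proof.
move=> rho0 t0; elim: n => [|n IH].
  by rewrite big_ord0 add0r expr0 divr1 le_max lexx orbT.
apply: (le_trans IH); rewrite big_ord_recr/= -addrA lerD2l.
have pn : 0 < rho / 2 ^+ n by rewrite divr_gt0// exprn_gt0.
rewrite indicE; have [/set_mem/in_ball2 h|nh] := boolP (y \in _).
  rewrite ge_max addr_ge0 ?le_max ?lexx//=.
  have -> : rho / 2 ^+ n / `|z - y| = 2 * (rho / 2 ^+ n.+1 / `|z - y|).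
    rewrite exprS invfM; set a := 2 ^- n; field; lra.
  rewrite lnM ?posrE//; last by rewrite !divr_gt0 ?exprn_gt0.
  by apply: lerD; [exact: ln2_le1|rewrite le_max lexx orbT].
rewrite add0r ge_max le_max lexx/=.
apply: (@le_trans _ _ 0); last by rewrite le_max lexx.
apply: ln_le0; rewrite ler_pdivrMr// mul1r.
by rewrite ltW// ltNge; apply: contra nh => h; apply/mem_set/in_ball2.
Qed.

Let dyadic_count z rho y : \bar R := (\sum_(0 <= k <oo) (\1_(ball2 z rho k) y)%:E)%E.

(** The remainder in the finite count vanishes as soon as [rho / 2 ^+ n <= |z - y|]. *)
Lemma ln_le_dyadic rho z y : 0 < rho -> 0 < `|z - y| ->
  ((ln (rho / `|z - y|))%:E <= dyadic_count z rho y)%E.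
Proof.
move=> rho0 t0.
have [n hn] : exists n, rho / 2 ^+ n / `|z - y| <= 1.
  exists (Num.bound (rho / `|z - y|)).
  set n := Num.bound _; have hb : rho / `|z - y| < n%:R.
    by rewrite (le_lt_trans _ (archi_boundP _))// ltW// divr_gt0.
  rewrite mulrAC ler_pdivrMr ?exprn_gt0// mul1r (le_trans (ltW hb))//.
  by rewrite -natrX ler_nat ltnW// ltn_expl.
have := ln_le_dyadic_count n rho0 t0.
have -> : Num.max 0 (ln (rho / 2 ^+ n / `|z - y|)) = 0.
  by apply/max_idPl; exact: ln_le0.
rewrite addr0 -lee_fin => /le_trans; apply.
rewrite -sumEFin -(big_mkord xpredT (fun k => (\1_(ball2 z rho k) y)%:E)).
by apply: nneseries_lim_ge => k _; rewrite lee_fin.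
Qed.

(** Scale [k] contributes the length [2 * rho / 2 ^+ k], and these form a geometric series of sum
    [4 * rho]. *)
Lemma integral_dyadic rho z : 0 < rho ->
  (\int[leb]_y dyadic_count z rho y <= (4 * rho)%:E)%E.
Proof.
move=> rho0.
rewrite (@integral_nneseries _ RT R leb setT measurableT
  (fun k y => (\1_(ball2 z rho k) y)%:E)); last 2 first.
- by move=> k; apply/measurable_EFinP; apply: measurable_indic; exact: measurable_itv.
- by move=> k x _; rewrite lee_fin.
apply: lime_le.
  by apply: is_cvg_nneseries => k _ _; apply: integral_ge0 => x _; rewrite lee_fin.
near=> n.
have -> : (\sum_(0 <= k < n) \int[leb]_x (\1_(ball2 z rho k) x)%:E =
   (\sum_(0 <= k < n) 2 * rho / 2 ^+ k)%:E)%E.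
  rewrite -sumEFin; apply: eq_bigr => k _.
  rewrite integral_indic// ?setIT; last exact: measurable_itv.
  have pk : 0 < rho / 2 ^+ k by rewrite divr_gt0// exprn_gt0.
  transitivity (z + rho / 2 ^+ k - (z - rho / 2 ^+ k))%:E; last by congr EFin; ring.
  by apply: lebesgue_measure_cc; lra.
rewrite lee_fin.
suff -> : \sum_(0 <= k < n) 2 * rho / 2 ^+ k = 4 * rho - 4 * rho / 2 ^+ n.
  by rewrite gerBl divr_ge0 ?exprn_ge0//; lra.
elim: (n) => [|m IH]; first by rewrite big_geq// expr0; lra.
rewrite big_nat_recr//= IH exprS invfM; set a := 2 ^- m; lra.
Unshelve. all: by end_near. Qed.

(** Split [C - ln |z - y|] into the constant [C - ln rho] and [ln (rho / |z - y|)]. The dyadic count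
    dominates the latter, and its integral over the whole line is controlled wherever [z] lies. *)
Lemma integral_pkernel_near C a rho z : 0 < rho -> rho <= 1 -> 0 <= C ->
  (\int[leb]_(y in `[a, (a + rho)%R]) pkernel C z y <= (rho * (C - ln rho + 4))%:E)%E.
Proof.
move=> rho0 rho1 C0.
have mJ : measurable (`[a, a + rho]%classic : set RT) by exact: measurable_itv.
have b0 : 0 <= C - ln rho by rewrite subr_ge0 (le_trans (ln_le0 rho1)).
have md : measurable_fun setT (dyadic_count z rho : RT -> \bar R).
  apply: (@ge0_emeasurable_sum _ RT R setT
      (fun k y => (\1_(ball2 z rho k) y)%:E) xpredT).
    by move=> k x _ _; rewrite lee_fin.
  move=> k _; apply/measurable_EFinP; apply: measurable_indic; exact: measurable_itv.
have d0 y : (0 <= dyadic_count z rho y)%E.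
  by apply: nneseries_ge0 => k _ _; rewrite lee_fin.
have le1 y : (pkernel C z y <= (C - ln rho)%:E + dyadic_count z rho y)%E.
  rewrite /pkernel ge_max; apply/andP; split; first by rewrite adde_ge0// lee_fin.
  rewrite /logkernel; case: eqVneq => [<-|zy].
    (* At [y = z] every indicator equals one, so the count diverges and absorbs the infinite value
       of the kernel. *)
    suff -> : dyadic_count z rho z = +oo%E by rewrite addey// leey.
    rewrite /dyadic_count; under eq_eseriesr => k _.
      rewrite indicE mem_set; last by apply/in_ball2; rewrite subrr normr0 divr_ge0 ?exprn_ge0// ltW.
      over.
    apply/eqyP => A A0; have [n hn] : exists n, A <= n%:R.
      by exists (Num.bound A); rewrite ltW// archi_boundP// ltW.
    apply: (@le_trans _ _ (\sum_(0 <= k < n) (1%R%:E : \bar R))%E).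
      by rewrite sumEFin lee_fin sumr_const_nat subn0.
    by apply: nneseries_lim_ge => k _; rewrite lee_fin.
  have t0 : 0 < `|z - y| by rewrite normr_gt0 subr_eq0.
  have := ln_le_dyadic rho0 t0.
  rewrite ln_div ?posrE// => h.
  rewrite (_ : (- ln `|z - y|)%:E + C%:E =
    (C - ln rho)%:E + (ln rho - ln `|z - y|)%:E)%E; first exact: leeD2l.
  by rewrite -!EFinD; congr EFin; ring.
apply: (@le_trans _ _ (\int[leb]_(y in `[a, (a + rho)%R])
    ((C - ln rho)%:E + dyadic_count z rho y))%E).
  apply: ge0_le_integral => //.
  - by move=> y _; exact: pkernel_ge0.
  - by apply: measurable_funTS; exact: measurable_pkernel.
  - by apply: emeasurable_funD; [exact: measurable_cst|exact: measurable_funTS].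
rewrite ge0_integralD//; last exact: measurable_funTS.
rewrite integral_cst//= lebesgue_measure_cc; last by lra.
rewrite -EFinM.
have -> : (rho * (C - ln rho + 4))%:E =
    (((C - ln rho) * (a + rho - a))%:E + (4 * rho)%:E)%E.
  by rewrite -EFinD; congr EFin; ring.
apply: leeD2l; apply: le_trans (integral_dyadic z rho0).
by apply: ge0_subset_integral => //.
Qed.

End NearEstimate.

(** * Averages of uniform measures on short intervals *)

Section SmearedMeasure.
Context {R : realType}.
Notation RT := (measurableTypeR R).
Notation leb := (@lebesgue_measure R).

Lemma uniform_prob_le (a b : R) (ab : a < b) (A : set RT) : measurable A ->
  (uniform_prob ab A <= ((b - a)^-1)%:E * leb A)%E.
Proof.
move=> mA; rewrite /uniform_prob -integral_cst//.
have ab0 : 0 <= (b - a)^-1 by rewrite invr_ge0 subr_ge0 ltW.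
apply: ge0_le_integral => //.
- by move=> x _; rewrite lee_fin uniform_pdf_ge0.
- by apply/measurable_EFinP; apply: measurable_funTS; exact: measurable_uniform_pdf.
- by move=> x _; rewrite lee_fin /uniform_pdf; case: ifP.
Qed.

Lemma uniform_prob_eq0 (a b : R) (ab : a < b) (A : set RT) :
  (forall x, a <= x <= b -> ~ A x) -> uniform_prob ab A = 0%E.
Proof.
move=> abA; apply: integral0_eq => x Ax; rewrite /uniform_pdf.
by case: ifP => // /abA.
Qed.

(** The witness is the average, over [x] in [s], of the uniform probabilities on [[a x, a x + rho]].
    As they share the length [rho], the density bound [rho^-1] survives averaging. *)
Lemma exists_smeared_measure (s : seq R) (a : R -> R) (rho : R) :
  s != [::] -> 0 < rho ->
  exists w : {measure set RT -> \bar R},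
  [/\ w setT = 1%E,
      (forall A, (forall x y, x \in s -> a x <= y <= a x + rho -> ~ A y) -> w A = 0%E),
      (forall A, measurable A -> (w A <= (rho^-1)%:E * leb A)%E) &
      forall (f : R -> \bar R) (b : R -> R),
        measurable_fun setT (f : RT -> \bar R) -> (forall x, 0 <= f x)%E ->
        (forall x, x \in s -> (\int[leb]_(y in `[a x, (a x + rho)%R]) f y <= (rho * b x)%:E)%E) ->
        (\int[w]_y f y <= ((\sum_(x <- s) b x) / (size s)%:R)%:E)%E].
Proof.
move=> s0 rho0; set n := size s.
have n0 : 0 < n%:R :> R by rewrite ltr0n lt0n size_eq0.
have nV : 0 <= n%:R^-1 :> R by rewrite invr_ge0 ltW.
have ax (x : R) : a x < a x + rho by rewrite ltrDl.
pose m (i : nat) : {measure set RT -> \bar R} :=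
  mscale (NngNum nV) (uniform_prob (ax (nth 0 s i))).
exists (msum m n); split.
- rewrite /= /msum; under eq_bigr do rewrite /m /= /mscale/= probability_setT mule1.
  by rewrite sumEFin sumr_const card_ord -(mulr_natl n%:R^-1) mulfV// gt_eqF.
- move=> A hA; rewrite /= /msum big1// => i _.
  rewrite /m /= /mscale/= uniform_prob_eq0 ?mule0// => x.
  by apply: hA; rewrite mem_nth.
- move=> A mA; rewrite /= /msum.
  apply: (@le_trans _ _ (\sum_(k < n) (n%:R^-1)%:E * ((rho^-1)%:E * leb A))%E).
    apply: lee_sum => i _; rewrite /m /= /mscale/=.
    apply: lee_wpmul2l; first by rewrite lee_fin.
    have := uniform_prob_le (ax (nth 0 s i)) mA.
    by rewrite (_ : a (nth 0 s i) + rho - a (nth 0 s i) = rho)//; ring.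
  rewrite -ge0_sume_distrl; last by move=> i _; rewrite lee_fin.
  rewrite sumEFin sumr_const card_ord -(mulr_natl n%:R^-1) mulfV ?gt_eqF//.
  by rewrite mul1e.
- move=> f b mf f0 fb; rewrite ge0_integral_measure_sum//.
  rewrite (big_nth 0) big_mkord mulr_suml -sumEFin.
  apply: lee_sum => i _; rewrite /m ge0_integral_mscale//.
  rewrite integral_uniform//.
  have -> : a (nth 0 s i) + rho - a (nth 0 s i) = rho by ring.
  rewrite /= mulrC EFinM; apply: lee_wpmul2l; first by rewrite lee_fin.
  have := fb _ (mem_nth 0 (ltn_ord i)); set xi := nth 0 s i => h.
  have : ((rho^-1)%:E * \int[leb]_(y in `[a xi, (a xi + rho)%R]) f y
     <= (rho^-1)%:E * (rho * b xi)%:E)%E.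
    by apply: lee_wpmul2l => //; rewrite lee_fin invr_ge0 ltW.
  by rewrite -EFinM mulrA mulVf ?gt_eqF// mul1r.
Qed.

(** A bounded potential prevents clustering: a point within [d] of [z] contributes at least
    [- ln (d + r)], any other at least [- ln (2 * D + 1)]. *)
Lemma count_near_le (D r d z : R) (s : seq R) : 0 < r -> r <= 1 -> 0 <= d ->
  (forall x, x \in s -> `|z - x| <= 2 * D) ->
  (count (fun x => `|z - x| <= d) s)%:R * (ln (2 * D + 1) - ln (d + r)) <=
  rpotential r s z + (size s)%:R * ln (2 * D + 1).
Proof.
move=> r0 r1 d0; rewrite /rpotential; elim: s => [|x s IH] sD.
  by rewrite big_nil !mul0r addr0.
have {}IH := IH (fun y ys => sD y (@mem_behead _ (x :: s) y ys)).
set L := ln (2 * D + 1) in IH *.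
rewrite big_cons/= natrD -[(size s).+1]add1n natrD !mulrDl !mul1r.
suff : (nat_of_bool (`|z - x| <= d)%R)%:R * (L - ln (d + r)) <=
  rkernel r (z - x) + L.
  by move: IH; lra.
have := rkernel_ge r0 r1 (sD x (mem_head _ _)); rewrite -/L.
move=> Lk; case: (leP `|z - x| d) => [zd|_]; rewrite /= ?mul0r ?mul1r; last by lra.
have := @ler_rkernel R r (z - x) d r0; rewrite (ger0_norm d0) => /(_ zd).
by rewrite {1}/rkernel (ger0_norm d0); lra.
Qed.

(** With [t = |z - x| > M * rho], the ratio of [t + r] to [t - 2 * rho] exceeds one by at most
    [3 * rho / ((M - 2) * rho)]; this is where [r <= rho] enters. *)
Lemma integral_pkernel_far (C a rho r z x M : R) :
  0 < rho -> 0 < r -> r <= rho -> 2 < M ->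
  0 <= C + rkernel r (z - x) ->
  (forall y, a <= y <= a + rho -> `|y - x| <= 2 * rho) -> M * rho < `|z - x| ->
  (\int[leb]_(y in `[a, (a + rho)%R]) pkernel C z y <=
   (rho * (rkernel r (z - x) + C + 3 / (M - 2)))%:E)%E.
Proof.
move=> rho0 r0 rrho M2 C0 near far.
have mJ : measurable (`[a, a + rho]%classic : set RT) by exact: measurable_itv.
set b := rkernel r (z - x) + C + 3 / (M - 2).
have M0 : 0 < 3 / (M - 2) by rewrite divr_gt0//; lra.
have b0 : 0 <= b by rewrite /b; lra.
apply: (@le_trans _ _ (\int[leb]_(y in `[a, (a + rho)%R]) b%:E)%E); last first.
  rewrite integral_cst//= lebesgue_measure_cc; last by lra.
  by rewrite -EFinM lee_fin; lra.
apply: ge0_le_integral => //.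
- by move=> y _; exact: pkernel_ge0.
- by apply: measurable_funTS; exact: measurable_pkernel.
move=> y /=; rewrite in_itv/= => ya.
have yx := near y ya.
set t := `|z - x| in far *.
have Mrho : 2 * rho < M * rho by rewrite ltr_pM2r.
have t2 : 0 < t - 2 * rho by lra.
have zy : t - 2 * rho <= `|z - y|.
  have := ler_normD (z - y) (y - x); rewrite subrKA -/t; lra.
have zy0 : 0 < `|z - y| by lra.
rewrite /pkernel ge_max lee_fin b0/= /logkernel.
case: eqVneq => [zey|_]; first by move: zy0; rewrite zey subrr normr0 ltxx.
rewrite -EFinD lee_fin.
have h1 : ln (t - 2 * rho) <= ln `|z - y| by rewrite ler_ln ?posrE.
have h2 : ln (t + r) - ln (t - 2 * rho) <= 3 / (M - 2).
  have tr : 0 < t + r by lra.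
  rewrite -ln_div ?posrE//; apply: (le_trans (ln_le_subr1 (divr_gt0 tr t2))).
  rewrite lerBlDr ler_pdivrMr// mulrDl mul1r.
  have : 3 * rho <= 3 / (M - 2) * (t - 2 * rho).
    rewrite -mulrA ler_pM2l// ler_pdivlMl; last lra.
    by rewrite mulrBl; lra.
  lra.
rewrite /b /rkernel -/t; lra.
Qed.

End SmearedMeasure.

(** * Approximation of the equilibrium potential *)

Section Potential.
Context {R : realType}.
Notation RT := (measurableTypeR R).
Notation leb := (@lebesgue_measure R).

Lemma exists_small_ln (A u : R) : 0 < u -> exists t, [/\ 0 < t, t <= u & A <= - ln t].
Proof.
move=> u0; exists (Num.min u (expR (- A))); split.
- by rewrite lt_min u0 expR_gt0.
- by rewrite ge_min lexx.
- rewrite lerNr -[leRHS]expRK ler_ln ?posrE ?expR_gt0 ?lt_min ?u0 ?expR_gt0//.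
  by rewrite ge_min lexx orbT.
Qed.

(** The potential is bounded on [K] only. Elsewhere, on a [w]-null set, it is majorized by [+oo],
    which does not change the outer integral. *)
Lemma log_energy_le (w : {measure set RT -> \bar R}) (K : set R) (C v : R) :
  compact K -> w setT = 1%E -> w (~` K) = 0%E ->
  (forall z, K z -> (\int[w]_y pkernel C z y <= (v + C)%:E)%E) ->
  (log_energy w <= v%:E)%E.
Proof.
move=> cK wT wK H.
have mK : measurable (K : set RT) by exact: compact_measurable.
have Kv z : K z -> (\int[w]_y logkernel z y <= v%:E)%E.
  move=> Kz.
  have mp := @measurable_pkernel R C z.
  have ip : w.-integrable setT (pkernel C z : RT -> \bar R).
    apply/integrableP; split => //.
    under eq_integral do rewrite gee0_abs ?pkernel_ge0//.
    by apply: (le_lt_trans (H _ Kz)); rewrite ltry.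
  have ic : w.-integrable setT (EFin \o cst C : RT -> \bar R).
    apply: measurable_bounded_integrable => //; first by rewrite wT ltry.
    exact: bounded_cst.
  apply: (@le_trans _ _ (\int[w]_y (pkernel C z y - C%:E))%E).
    by apply: le_integral_pointwise => y; exact: logkernel_le_pkernel.
  rewrite (integralB measurableT ip ic) /= integral_cst// wT mule1.
  by rewrite leeBlDr//; apply: H.
apply: (@le_trans _ _ (\int[w]_x (if x \in K then v%:E else +oo))%E).
  apply: le_integral_pointwise => x; case: ifPn => [/set_mem/Kv//|_].
  exact: leey.
rewrite (@ae_eq_integral _ RT R w setT (fun=> v%:E)) => [| | | |]; [| exact: measurableT| | |].
- by rewrite integral_cst// wT mule1.
- apply: measurable_fun_ifT => //; apply: (measurable_fun_bool true).
  rewrite setTI (_ : _ @^-1` _ = K)//.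
  by apply/seteqP; split => x /=; [move/set_mem|move/mem_set].
- exact: measurable_cst.
- exists (~` K); split => //; first exact: measurableC.
  by move=> x /= nH Kx; apply: nH => _; rewrite mem_set.
Qed.

Variables (K E : set R) (D rho0 : R).
Hypotheses (cK : compact K) (KD : forall x, K x -> `|x| <= D) (EK : E `<=` K).
Hypotheses (E0 : E !=set0) (rho00 : 0 < rho0).
Hypothesis Eitv : forall rho e : R, 0 < rho -> rho <= rho0 -> E e ->
  exists2 a, `[a, a + rho]%classic `<=` E & a <= e <= a + rho.
Hypothesis Kfin : forall d : R, 0 < d -> exists Q : seq R,
  forall x, K x -> x \in Q \/ exists2 e, E e & `|x - e| < d.

Let C := ln (2 * D + 1).

Let D0 : 0 <= D.
Proof. by case: E0 => e /EK/KD; apply: le_trans. Qed.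

Let C0 : 0 <= C.
Proof. by apply: ln_ge0; move: D0; lra. Qed.

Lemma dist_le_diam (x y : R) : `|x| <= D -> `|y| <= D -> `|x - y| <= 2 * D.
Proof. by move=> xD yD; apply: (le_trans (ler_normB _ _)); lra. Qed.

Let good (rho x : R) : bool := `[< exists2 e, E e & `|x - e| < rho >].

(* Points near [E] are smeared over a nearby interval of [E], the few others
   over an arbitrary one. *)
Lemma smeared_potential_le (rho r M : R) (s : seq R) : 0 < rho -> rho <= rho0 -> rho <= 1 ->
  0 < r -> r <= rho -> 2 < M -> s != [::] -> (forall x, x \in s -> K x) ->
  exists w : {measure set RT -> \bar R},
  [/\ w setT = 1%E, (forall A, (forall y, E y -> ~ A y) -> w A = 0%E),
      (forall A, measurable A -> (w A <= (rho^-1)%:E * leb A)%E) &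
      forall z, `|z| <= D -> (\int[w]_y pkernel C z y <=
        ((rpotential r s z + (count (fun x => `|z - x| <= M * rho)%R s)%:R * (4 + ln (M + 1))
         + (count (fun x => ~~ good rho x) s)%:R * (4 - ln rho + C)) / (size s)%:R
         + C + 3 / (M - 2))%:E)%E].
Proof.
move=> rho_gt0 le_rho0 rho1 r0 rrho M2 s0 sK.
have [e0 Ee0] := E0.
have r1 : r <= 1 by lra.
have exa x : exists a, `[a, a + rho]%classic `<=` E /\
    (good rho x -> forall y, a <= y <= a + rho -> `|y - x| <= 2 * rho).
  case: (boolP (good rho x)) => [/asboolP[e Ee xe]|_].
    have [a aE /andP[ae ea]] := Eitv rho_gt0 le_rho0 Ee.
    exists a; split => // _ y /andP[ay ya].
    move: xe; rewrite ltr_norml => /andP[? ?].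
    by rewrite ler_norml; apply/andP; split; lra.
  have [a aE _] := Eitv rho_gt0 le_rho0 Ee0.
  by exists a.
have [a Ha] := choice exa.
have [w [wT w0 wleb wint]] := exists_smeared_measure a s0 rho_gt0.
exists w; split => //.
  move=> A EA; apply: w0 => x y xs xy; apply: EA; apply: (Ha x).1.
  by rewrite /= in_itv.
move=> z zD.
have n0 : 0 < (size s)%:R :> R by rewrite ltr0n lt0n size_eq0.
have M0 : 0 < 3 / (M - 2) by rewrite divr_gt0//; lra.
have lnM0 : 0 <= ln (M + 1) by apply: ln_ge0; lra.
have lnrho : ln rho <= 0 by exact: ln_le0.
have [Ce CeE] : exists Ce, Ce = C + 3 / (M - 2) by eexists.
(* The bound per point is that of the far case, plus a surcharge for points within [M * rho] of [z]
   and another for points not close to [E]. *)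
pose b x := rkernel r (z - x) + Ce
  + (nat_of_bool (`|z - x| <= M * rho)%R)%:R * (4 + ln (M + 1))
  + (nat_of_bool (~~ good rho x))%:R * (4 - ln rho + C).
apply: le_trans (wint _ b (measurable_pkernel _ _) (pkernel_ge0 _ _) _) _.
  move=> x xs.
  have kC : 0 <= C + rkernel r (z - x).
    have := @rkernel_ge R D r (z - x) r0 r1 (dist_le_diam zD (KD (sK _ xs))).
    by rewrite -/C; lra.
  case: (boolP (good rho x)) => gx; last first.
    apply: (le_trans (integral_pkernel_near _ _ rho_gt0 rho1 C0)).
    rewrite lee_fin ler_pM2l// /b CeE gx mul1r.
    have : 0 <= (nat_of_bool (`|z - x| <= M * rho)%R)%:R * (4 + ln (M + 1)).
      by rewrite mulr_ge0//; lra.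
    lra.
  case: (leP `|z - x| (M * rho)) => zx.
    apply: (le_trans (integral_pkernel_near _ _ rho_gt0 rho1 C0)).
    rewrite lee_fin ler_pM2l// /b CeE gx zx mul1r mul0r.
    (* Here [|z - x| + r <= (M + 1) * rho], so replacing the kernel by [- ln rho] costs at most
       [ln (M + 1)]. *)
    have : - ln ((M + 1) * rho) <= rkernel r (z - x).
      have Mr : 0 < (M + 1) * rho by rewrite mulr_gt0//; lra.
      rewrite /rkernel lerN2 ler_ln ?posrE ?ltr_wpDl//; lra.
    rewrite lnM ?posrE//; lra.
  apply: (le_trans (integral_pkernel_far rho_gt0 r0 rrho M2 kC ((Ha x).2 gx) zx)).
  by rewrite lee_fin ler_pM2l// /b CeE gx [`|z - x| <= _]leNgt zx !mul0r; lra.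
have cnt (p : pred R) : (count p s)%:R = \sum_(i <- s) (nat_of_bool (p i))%:R :> R.
  by rewrite -natr_sum -sum1_count big_mkcond.
rewrite lee_fin /b !cnt !big_split/= sumr_const_seq -!mulr_suml CeE.
rewrite -/(rpotential r s z) le_eqVlt; apply/orP; left; apply/eqP.
move: (3 / (M - 2)) (rpotential r s z) (size s)%:R n0 => e3 S n n0.
by field; rewrite gt_eqF.
Qed.

(** Each of the three error terms of [smeared_potential_le] is at most [eta]: the choice of [M]
    gives [3 / (M - 2) = eta], and by [count_near_le] the bound [B] limits both the points within
    [M * rho] of [z] and the multiplicity in [s] of each of the finitely many points of [Q]. *)
Lemma smeared_potential_le_of_scales (rho r M eta B : R) (Q s : seq R) :
  0 < rho -> rho <= rho0 -> rho <= 1 -> 0 < r -> r <= rho -> 0 < eta ->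
  M = 2 + 3 / eta -> 0 < B ->
  0 < C - ln ((M + 1) * rho) ->
  B * (4 + ln (M + 1)) <= eta * (C - ln ((M + 1) * rho)) ->
  (forall x, K x -> x \in Q \/ exists2 e, E e & `|x - e| < rho) ->
  (size Q)%:R * B * (4 - ln rho + C) <= eta * (C - ln r) ->
  s != [::] -> (forall x, x \in s -> K x) ->
  (forall z, rpotential r s z + (size s)%:R * C <= (size s)%:R * B) ->
  exists w : {measure set RT -> \bar R},
  [/\ w setT = 1%E, (forall A, (forall y, E y -> ~ A y) -> w A = 0%E),
      (forall A, measurable A -> (w A <= (rho^-1)%:E * leb A)%E) &
      forall z, `|z| <= D -> (\int[w]_y pkernel C z y <=
        (rpotential r s z / (size s)%:R + C + 3 * eta)%:E)%E].
Proof.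
move=> rho_gt0 le_rho0 rho1 r0 rrho eta0 EM B0 L0 HB HQ HQB s0 sK HS.
have r1 : r <= 1 by lra.
have n0 : 0 < (size s)%:R :> R by rewrite ltr0n lt0n size_eq0.
have lnrho : ln rho <= 0 by exact: ln_le0.
have lnr : ln r <= 0 by exact: ln_le0.
have eta3 : 0 < 3 / eta by rewrite divr_gt0.
have M2 : 2 < M by lra.
have lnM0 : 0 <= ln (M + 1) by apply: ln_ge0; lra.
have [w [wT wE wleb wint]] := smeared_potential_le rho_gt0 le_rho0 rho1 r0 rrho M2 s0 sK.
exists w; split => // z zD; apply: (le_trans (wint _ zD)); rewrite lee_fin.
have sD y : `|y| <= D -> forall x, x \in s -> `|y - x| <= 2 * D.
  by move=> yD x xs; apply: dist_le_diam => //; apply: KD; exact: sK.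
have -> : 3 / (M - 2) = eta.
  by rewrite EM addrC addKr invfM invrK mulrA mulfV ?mul1r.
set cb := (count _ s)%:R; set cn := (count _ s)%:R.
have Hn : cn * (4 + ln (M + 1)) <= (size s)%:R * eta.
  have cnL : cn * (C - ln ((M + 1) * rho)) <= (size s)%:R * B.
    have Mr0 : 0 < M * rho by rewrite mulr_gt0//; lra.
    have Mr1 : 0 < (M + 1) * rho by rewrite mulr_gt0//; lra.
    apply: le_trans (HS z).
    apply: le_trans (count_near_le r0 r1 (ltW Mr0) (sD _ zD)).
    by rewrite -/C ler_wpM2l// lerD2l lerN2 ler_ln ?posrE ?addr_gt0//; lra.
  rewrite -(ler_pM2r L0) mulrAC.
  apply: (@le_trans _ _ ((size s)%:R * B * (4 + ln (M + 1)))).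
    by rewrite ler_wpM2r//; lra.
  by rewrite -!mulrA ler_wpM2l.
have Hb : cb * (4 - ln rho + C) <= (size s)%:R * eta.
  have [->|Q0] := eqVneq cb 0; first by rewrite mul0r mulr_ge0// ltW.
  have cbL : cb * (C - ln r) <= (size Q)%:R * ((size s)%:R * B).
    have cbQ : cb <= \sum_(q <- Q) (count (pred1 q) s)%:R.
      rewrite /cb -natr_sum ler_nat.
      rewrite [leqRHS](_ : _ = \sum_(x <- s) count_mem x Q)%N; last first.
        under eq_bigr do rewrite -sum1_count big_mkcond/=.
        rewrite exchange_big/=; apply: eq_bigr => x _.
        by rewrite -sum1_count [RHS]big_mkcond/=; apply: eq_bigr => q _; rewrite eq_sym.
      rewrite -sum1_count big_mkcond/= big_seq [leqRHS]big_seq; apply: leq_sum => x xs.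
      case: ifP => // /negP ng; rewrite -has_count has_pred1.
      by have [//|ex] := HQ _ (sK _ xs); case: ng; apply/asboolP.
    have CLr : 0 <= C - ln r by move: C0; lra.
    apply: (le_trans (ler_wpM2r CLr cbQ)).
    rewrite mulr_suml -sumr_const_seq; apply: ler_sum_seq => q qQ.
    have [qs|nqs] := boolP (q \in s); last first.
      rewrite (_ : count _ _ = 0%N) ?mul0r; first by rewrite mulr_ge0// ltW.
      by apply/eqP; rewrite -leqn0 leqNgt -has_count has_pred1.
    (* Radius [d = 0] counts the multiplicity of [q] in [s]. *)
    have := count_near_le r0 r1 (lexx 0) (sD q (KD (sK _ qs))).
    rewrite add0r -/C => h; apply: le_trans (HS q); apply: le_trans h.
    rewrite ler_wpM2r// ler_nat; apply: sub_count => x /= /eqP->.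
    by rewrite subrr normr0.
  (* If this vanished, [HQB] would force [Q] to be empty, hence all points to be close to [E] and
     [cb = 0]. *)
  have CL : 0 < C - ln r.
    rewrite lt_neqAle; apply/andP; split; last by move: C0; lra.
    apply/negP => /eqP Clr.
    have : 0 < (size Q)%:R * B * (4 - ln rho + C).
      rewrite !mulr_gt0//; last by move: C0; lra.
      rewrite ltr0n lt0n; apply: contra Q0 => /eqP/size0nil Q0.
      rewrite /cb (_ : count _ _ = 0%N)//; apply/eqP; rewrite -leqn0 leqNgt -has_count.
      apply/hasPn => x xs; rewrite negbK; apply/asboolP.
      by have [|//] := HQ _ (sK _ xs); rewrite Q0.
    by move: HQB; rewrite -Clr mulr0; lra.
  rewrite -(ler_pM2r CL) mulrAC.
  apply: (@le_trans _ _ ((size Q)%:R * ((size s)%:R * B) * (4 - ln rho + C))).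
    by rewrite ler_wpM2r//; move: C0; lra.
  rewrite -[leRHS]mulrA mulrCA -mulrA ler_wpM2l//; lra.
set n := (size s)%:R in n0 Hn Hb *.
have Hn' : cn * (4 + ln (M + 1)) / n <= eta by rewrite ler_pdivrMr// [leRHS]mulrC.
have Hb' : cb * (4 - ln rho + C) / n <= eta by rewrite ler_pdivrMr// [leRHS]mulrC.
rewrite !mulrDl; lra.
Qed.

Let infE : \bar R := ereal_inf [set log_energy nu | nu in prob_on K].

(** The competitor is a single point of [E] smeared over an interval of [E]; its potential is
    bounded on [K]. *)
Lemma inf_energy_lty : (infE < +oo)%E.
Proof.
pose rho := Num.min rho0 1.
have rho_gt0 : 0 < rho by rewrite lt_min rho00 ltr01.
have le_rho0 : rho <= rho0 by rewrite ge_min lexx.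
have rho1 : rho <= 1 by rewrite ge_min lexx orbT.
have [e0 Ee0] := E0.
have lnrho : ln rho <= 0 by exact: ln_le0.
have ln4 : 0 <= ln (3 + 1) :> R by apply: ln_ge0; lra.
have M2 : 2 < 3 :> R by lra.
have sK x : x \in [:: e0] -> K x by rewrite inE => /eqP->; exact: EK.
have [w [wT wE _ wint]] := smeared_potential_le rho_gt0 le_rho0 rho1 rho_gt0
  (lexx _) M2 (isT : [:: e0] != [::]) sK.
have wK : w (~` K) = 0%E by apply: wE => y /EK Ky; exact.
pose B := 1 + (- ln rho + (4 + ln (3 + 1)) + (4 - ln rho + C) + C + 3 / (3 - 2)) - C.
apply: (@le_lt_trans _ _ B%:E); last by rewrite ltry.
apply: (@le_trans _ _ (log_energy w)).
  by apply: ereal_inf_lbound; exists w.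
apply: (log_energy_le cK wT wK) => z Kz; apply: (le_trans (wint z (KD Kz))).
rewrite lee_fin /B /= !addn0 divr1.
have : rpotential rho [:: e0] z <= - ln rho.
  by rewrite /rpotential big_seq1; exact: rkernel_le.
have h (b : bool) (c : R) : 0 <= c -> (nat_of_bool b)%:R * c <= c.
  by move=> c0; case: b; rewrite ?mul1r ?mul0r.
have u1 : 0 <= 4 + ln (3 + 1) :> R by move: ln4; lra.
have u2 : 0 <= 4 - ln rho + C by move: C0; lra.
move: (h (`|z - e0| <= 3 * rho) _ u1) (h (~~ good rho e0) _ u2); lra.
Qed.

(** For the lower bound, compare with the regularized energy at [r = 1], whose kernel is at least
    [- C] on [K]. *)
Lemma inf_energy_fin : exists V : R, infE = V%:E /\ 0 <= V + C.
Proof.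
have le_inf : ((- C)%:E <= infE)%E.
  apply: le_ereal_inf_tmp => _ [nu [nuT nuK] <-].
  apply: le_trans (kenergy_le_log_energy cK nuT nuK ltr01); rewrite lee_fin.
  apply: mean_ge => //; first exact: kpotential_continuous.
  move=> x Kx; apply: mean_ge => //; first exact: rkernel_shift_continuous.
  move=> y Ky; apply: rkernel_ge => //.
  by apply: dist_le_diam; exact: KD.
have := inf_energy_lty; move: le_inf; case: infE => // V; rewrite lee_fin => h _.
by exists V; split => //; lra.
Qed.

(** The potential of the points nowhere exceeds its value at a point of [K] by more than a constant
    [Cr]. Its mean over the points, bounded by the energy, gives the upper bound; the smeared
    measure [w] competes for the infimum [V], which gives the lower bound. The scales are fixed in
    the order [rho], [Q], [r], [n], so that [A = rho^-1] does not depend on [n]. *)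
Theorem equilibrium_approximation : exists2 V : R, infE = V%:E &
  forall eps : R, 0 < eps -> exists (A : R) n0, [/\ 0 < A, (0 < n0)%N &
  forall n, (n0 <= n)%N -> exists r s (w : {measure set RT -> \bar R}),
  [/\ 0 < r, size s = n, (forall x, x \in s -> K x) &
      (forall g, K g -> n%:R * (V - eps) <= rpotential r s g)] /\
  [/\ w setT = 1%E, (forall A, (forall y, E y -> ~ A y) -> w A = 0%E),
      (forall B, measurable B -> (w B <= A%:E * leb B)%E) &
      forall z, `|z| <= D -> (\int[w]_y pkernel C z y <= (V + eps + C)%:E)%E]].
Proof.
have [V [VE VC]] := inf_energy_fin.
exists V => // eps eps0.
(* The upper bound loses [2 * eta] for the points and [3 * eta] in the smearing. *)
pose eta := eps / 5; have eta0 : 0 < eta by rewrite /eta; lra.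
have fV : infE \is a fin_num by rewrite VE.
have [_ [nu [nuT nuK] <-] nuV] := lb_ereal_inf_adherent eta0 fV.
rewrite -/infE VE -EFinD in nuV.
pose M := 2 + 3 / eta; pose B := V + C + 2 * eta.
have eta3 : 0 < 3 / eta by rewrite divr_gt0.
have B0 : 0 < B by rewrite /B; lra.
have lnM0 : 0 <= ln (M + 1) by apply: ln_ge0; rewrite /M; lra.
have u0 : 0 < Num.min rho0 1 by rewrite lt_min rho00 ltr01.
(* The summand [1] makes [C - ln ((M + 1) * rho)] strictly positive. *)
have [rho [rho_gt0 rhole Hrho]] := exists_small_ln
  (B * (4 + ln (M + 1)) / eta + ln (M + 1) + 1 - C) u0.
have [rho_le0 rho1] : rho <= rho0 /\ rho <= 1.
  by move: rhole; rewrite le_min => /andP[].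
have lnrho : ln rho <= 0 by exact: ln_le0.
have LE : ln ((M + 1) * rho) = ln (M + 1) + ln rho.
  by rewrite lnM ?posrE//; rewrite /M; lra.
have [Q HQ] := Kfin rho_gt0.
have [r [r0 rrho Hr]] := exists_small_ln
  ((size Q)%:R * B * (4 - ln rho + C) / eta - C) rho_gt0.
have r1 : r <= 1 by lra.
pose I := kenergy nu K r.
have IV : I <= V + eta.
  have := kenergy_le_log_energy cK nuT nuK r0.
  by move=> /le_lt_trans/(_ nuV); rewrite lte_fin => /ltW.
pose Cr := 1 - ln r + C.
have Cr0 : 0 <= Cr by have := ln_le0 r1; rewrite /Cr; move: C0; lra.
pose kap := 2 - ln r - I.
(* [n * T] dominates the terms of order [n] in the energy comparison; [T <= n * eta] then makes them
   at most [n ^ 2 * eta]. *)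
pose T := `|kap| + 1 + Cr.
have T0 : 0 <= T by rewrite /T; have := normr_ge0 kap; lra.
exists rho^-1, (Num.bound (T / eta)).+1; split => //; first by rewrite invr_gt0.
move=> n nb.
have n0 : 0 < n%:R :> R by rewrite ltr0n (leq_trans _ nb).
have nT : T <= n%:R * eta.
  rewrite -ler_pdivrMr//; apply: (le_trans (ltW (archi_boundP _))).
    by rewrite divr_ge0// ltW.
  by rewrite ler_nat ltnW.
have KDD x y : K x -> K y -> `|x - y| <= 2 * D.
  by move=> /KD ? /KD ?; exact: dist_le_diam.
have K0 : K !=set0 by case: E0 => e /EK; exists e.
have [s [sn sK smin sle]] := exists_near_minimizer n r0 r1 KDD K0.
have s0 : s != [::] by rewrite -size_eq0 sn -lt0n -(ltr0n R).
have Smax g z : K g -> rpotential r s z <= rpotential r s g + Cr.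
  move=> Kg; have [x xs xz] := maximum_principle z r0 s0.
  by apply: (le_trans xz); exact: sle.
have Sub z : rpotential r s z <= n%:R * (V + 2 * eta).
  have cf : continuous (cst 0 : R -> R) by move=> x; exact: cvg_cst.
  have [s' [s'n s'K Hs']] := exists_energy_le_mean cK nuT nuK r0 n cf.
  have HP := smin _ s'n s'K.
  have : n%:R * rpotential r s z <= renergy r s + n%:R * Cr.
    rewrite -sn -!sumr_const_seq /renergy -big_split; apply: ler_sum_seq => x xs.
    by apply: Smax; exact: sK.
  move: Hs'; rewrite /= big1// Rintegral_cst//; last exact: compact_measurable.
  rewrite mul0r !mulr0 !addr0 -/I -/kap => Hs' HS.
  have : n%:R * rpotential r s z <= n%:R * (n%:R * I + `|kap| + 1 + Cr).
    apply: (le_trans HS).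
    have n1 : 1 <= n%:R :> R by rewrite (ler_nat _ 1) -(ltr0n R).
    have hk := ler_wpM2l (ltW n0) (ler_norm kap).
    rewrite expr2 in Hs'.
    have -> : n%:R * (n%:R * I + `|kap| + 1 + Cr) =
        n%:R * n%:R * I + n%:R * `|kap| + n%:R + n%:R * Cr by ring.
    rewrite lerD2r (le_trans HP)// lerD// (le_trans Hs')// lerD2l//.
  rewrite ler_pM2l// => HS2; apply: (le_trans HS2).
  have := ler_wpM2l (ltW n0) IV; move: nT; rewrite /T; lra.
have HB z : rpotential r s z + (size s)%:R * C <= (size s)%:R * B.
  by rewrite sn /B; have := Sub z; lra.
have X1 : B * (4 + ln (M + 1)) / eta + 1 <= C - ln ((M + 1) * rho).
  by rewrite LE; lra.
have X2 : 0 <= B * (4 + ln (M + 1)) / eta.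
  by rewrite divr_ge0 ?mulr_ge0 ?(ltW B0) ?(ltW eta0)//; lra.
have [|||w [wT wE wleb wint]] := smeared_potential_le_of_scales (M := M) (Q := Q)
  rho_gt0 rho_le0 rho1 r0 rrho eta0 erefl B0 _ _ HQ _ s0 sK HB.
- by lra.
- by rewrite -ler_pdivrMl// mulrC; lra.
- by rewrite -ler_pdivrMl// mulrC; lra.
exists r, s, w; split; split => //.
  move=> g Kg.
  have wK : w (~` K) = 0%E by apply: wE => y /EK Ky; exact.
  have : (log_energy w <= ((rpotential r s g + Cr) / n%:R + 3 * eta)%:E)%E.
    apply: (log_energy_le cK wT wK) => z Kz.
    apply: (le_trans (wint z (KD Kz))); rewrite lee_fin sn.
    have : rpotential r s z / n%:R <= (rpotential r s g + Cr) / n%:R.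
      by rewrite ler_pM2r ?invr_gt0//; exact: Smax.
    lra.
  have : (infE <= log_energy w)%E by apply: ereal_inf_lbound; exists w.
  move=> /le_trans/[apply]; rewrite VE lee_fin -lerBlDr ler_pdivlMr//.
  have : Cr <= T by rewrite /T; have := normr_ge0 kap; lra.
  move: nT; rewrite /eta; lra.
move=> z zD; apply: (le_trans (wint z zD)); rewrite lee_fin sn.
have : rpotential r s z / n%:R <= V + 2 * eta by rewrite ler_pdivrMr// mulrC.
rewrite /eta; lra.
Qed.

End Potential.

(** * Real-rooted minorants and supports *)

Section RealRoots.
Context {R : rcfType}.

(* Moving a root [z] first to [Re z] and then to the nearest point of [-D, D]
   brings it closer to every point of [-D, D]. *)
Lemma monic_ge_real_rooted (P : {poly R}) (D : R) n : 0 <= D ->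
  P \is monic -> size P = n.+1 ->
  exists s : seq R, [/\ size s = n, (forall r, r \in s -> `|r| <= D) &
    forall x, `|x| <= D -> \prod_(r <- s) `|x - r| <= `|P.[x]|].
Proof.
move=> D0 mP sP.
pose iota : {rmorphism R -> R[i]} := real_complex R.
have [s Hs] := closed_field_poly_normal (map_poly iota P).
rewrite lead_coef_map (monicP mP) rmorph1 scale1r in Hs.
pose clamp (x : R) := Num.max (- D) (Num.min x D).
have clampD x : `|clamp x| <= D.
  rewrite ler_norml /clamp le_max lexx/= ge_max; apply/andP; split; first lra.
  by rewrite ge_min lexx orbT.
have clamp_le x y : `|x| <= D -> `|x - clamp y| <= `|x - y|.
  rewrite ler_norml => /andP[Dx xD]; rewrite /clamp.
  case: (leP y D) => yD; case: (leP (- D) _) => yD' //.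
  - by rewrite !ger0_norm ?subr_ge0//; lra.
  - by rewrite !ler0_norm ?subr_le0//; lra.
  - by exfalso; lra.
exists (map (fun z => clamp (complex.Re z)) s); split.
- by rewrite size_map; have := congr1 (fun p : {poly _} => size p) Hs;
    rewrite /= size_map_poly sP size_prod_XsubC => -[].
- by move=> r /mapP[z _ ->].
move=> x xD; rewrite big_map -lecR.
have -> : real_complex R `|P.[x]| = `|(map_poly iota P).[iota x]|.
  by rewrite horner_map normc_def /= expr0n addr0 sqrtr_sqr.
rewrite Hs horner_prod normr_prod rmorph_prod.
apply: ler_prod => z _; rewrite hornerXsubC; apply/andP; split.
  by rewrite ler0c.
apply: le_trans (normc_ge_Re _).
rewrite lecR; apply: (le_trans (clamp_le _ _ xD)).
by case: z.
Qed.

End RealRoots.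

(** * Support and essential support *)

Section Support.
Context {R : realType}.
Notation RT := (measurableTypeR R).
Variable mu : {measure set RT -> \bar R}.

(** Every point off the support lies in a null interval with rational endpoints, and there are
    countably many of these. *)
Lemma msupp_compl_null : measurable (msupp mu : set RT) -> mu (~` msupp mu) = 0%E.
Proof.
move=> mK.
pose I (pq : rat * rat) : set R := `]ratr pq.1, ratr pq.2[%classic.
pose F n : set RT := if unpickle n is Some pq then
  (if mu (I pq) == 0%E then I pq else set0) else set0.
have mF n : measurable (F n).
  by rewrite /F; case: unpickle => [pq|//]; case: ifP => // _; exact: measurable_itv.
have F0 n : mu (F n) = 0%E.
  by rewrite /F; case: unpickle => [pq|]; [case: ifP => [/eqP->//|_]|]; rewrite measure0.
have mU : measurable (\bigcup_n F n) by exact: bigcupT_measurable.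
have sub : ~` msupp mu `<=` \bigcup_n F n.
  move=> x /= /existsNP[e /not_implyP[e0 /negP]].
  rewrite -leNgt => mu0.
  have [p /andP[xp px]] : exists p : rat, x - e < ratr p < x.
    by have [p] := @rat_in_itvoo R (x - e) x ltac:(lra); rewrite in_itv/=; exists p.
  have [q /andP[xq qx]] : exists q : rat, x < ratr q < x + e.
    by have [q] := @rat_in_itvoo R x (x + e) ltac:(lra); rewrite in_itv/=; exists q.
  exists (pickle (p, q)); first exact: Logic.I.
  rewrite /F pickleK ifT; last first.
    apply/eqP/le_anti; rewrite measure_ge0 andbT; apply: le_trans mu0.
    apply: le_measure; rewrite ?inE.
    - exact: measurable_itv.
    - rewrite (_ : [set y | _] = `]x - e, x + e[%classic); first exact: measurable_itv.
      by apply/seteqP; split => y /=; rewrite in_itv.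
    - by move=> y; rewrite /I /= in_itv/= => /andP[? ?]; apply/andP; split; lra.
  by rewrite /I /= in_itv/= px xq.
have U0 : mu (\bigcup_n F n) = 0%E.
  apply/eqP; rewrite eq_le measure_ge0 andbT.
  have := @measure_sigma_subadditive _ R RT mu _ F mF mU (@subset_refl _ _).
  move=> /le_trans; apply.
  by rewrite eseries0// => n _ _; rewrite F0.
apply/eqP; rewrite eq_le measure_ge0 andbT -U0; apply: le_measure => //.
  by rewrite inE; exact: measurableC.
by rewrite inE.
Qed.

Lemma ess_supp_subset : ess_supp mu `<=` msupp mu.
Proof. by move=> x []. Qed.

(** Cover the support by balls of radius [d] at essential points and isolating balls at the others.
    The centres of a finite subcover form [Q]. *)
Lemma msupp_near_ess_supp (d : R) : compact (msupp mu) -> 0 < d ->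
  exists Q : seq R, forall x, msupp mu x ->
    x \in Q \/ exists2 e, ess_supp mu e & `|x - e| < d.
Proof.
move=> cK d0.
have rad p : exists e : R, 0 < e /\ (msupp mu p ->
    forall x, msupp mu x -> `|x - p| < e ->
      x = p \/ exists2 e, ess_supp mu e & `|x - e| < d).
  have [Ep|nEp] := pselect (ess_supp mu p).
    by exists d; split => // _ x _ xp; right; exists p.
  have [Kp|nKp] := pselect (msupp mu p); last by exists 1; split.
  have [e [e0 He]] : exists e : R, 0 < e /\
      ~ exists y, msupp mu y /\ y != p /\ `|y - p| < e.
    apply: contrapT => H; apply: nEp; split => // e e0.
    by apply: contrapT => H'; apply: H; exists e.
  exists e; split => // _ x Kx xp; left; apply/eqP; apply: contrapT => /negP xnp.
  by apply: He; exists x.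
have [f Hf] := choice rad.
have := cK; rewrite compact_cover => /(_ R (msupp mu) (fun p => ball p (f p))) [].
- by move=> p _; exact: ball_open.
- by move=> x Kx; exists x => //; apply: (ballxx x); exact: (Hf x).1.
move=> S SK cov.
exists (finmap.enum_fset S) => x Kx.
have [p /= pS] := cov _ Kx; rewrite /ball/= distrC => xp.
have Kp : msupp mu p by exact/set_mem/SK.
by have [->|] := (Hf p).2 Kp x Kx xp; [left|right].
Qed.

End Support.

(** * Norms of monic polynomials *)

Section Bounds.
Context {R : realType}.
Notation RT := (measurableTypeR R).
Notation leb := (@lebesgue_measure R).

Lemma measurable_horner_sqr (P : {poly R}) :
  measurable_fun setT (fun x : RT => (`|P.[x]| ^+ 2)%:E).
Proof.
apply/measurable_EFinP; apply: measurable_funX; apply: measurableT_comp.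
  exact: normr_measurable.
by apply: continuous_measurable_fun; exact: continuous_horner.
Qed.

(** The test polynomial has roots [s]; since [|x - y| <= |x - y| + r], its modulus at [x] is at most
    [expR (- rpotential r s x)]. *)
Lemma monic_integral_le (mu : {measure set RT -> \bar R}) (K : set R) (r W : R) (s : seq R) :
  measurable (K : set RT) -> mu (~` K) = 0%E -> 0 < r ->
  (forall g, K g -> (size s)%:R * W <= rpotential r s g) ->
  (ereal_inf [set (\int[mu]_x ((`|P.[x]| ^+ 2)%R)%:E)%E | P in @monic_deg R (size s)]
   <= (expR (- (2 * (size s)%:R * W)))%:E * mu setT)%E.
Proof.
move=> mK muK r0 HS.
pose P : {poly R} := \prod_(x <- s) ('X - x%:P).
apply: (@le_trans _ _ (\int[mu]_x ((`|P.[x]| ^+ 2)%R)%:E)%E).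
  apply: ereal_inf_lbound; exists P => //; split; first exact: monic_prod_XsubC.
  exact: size_prod_XsubC.
rewrite (ge0_negligible_integral (measurableC mK) measurableT (measurable_horner_sqr P) _ muK);
  last by move=> x _; rewrite lee_fin exprn_ge0.
rewrite setDE setTI setCK.
apply: (@le_trans _ _ (\int[mu]_(x in K) (expR (- (2 * (size s)%:R * W)))%:E)%E); last first.
  rewrite integral_cst//; apply: lee_wpmul2l; first by rewrite lee_fin expR_ge0.
  by apply: le_measure; rewrite ?inE.
apply: ge0_le_integral => //.
- by apply: measurable_funTS; exact: measurable_horner_sqr.
move=> x Kx; rewrite lee_fin.
apply: (@le_trans _ _ (expR (- rpotential r s x) ^+ 2)).
  rewrite ler_pXn2r ?nnegrE ?expR_ge0//.
  rewrite /P horner_prod normr_prod /rpotential -sumrN expR_sum.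
  apply: ler_prod => y _; rewrite hornerXsubC normr_ge0/= opprK lnK ?posrE ?ltr_wpDl//.
  by rewrite lerDl ltW.
by rewrite -expRM_natl ler_expR; have := HS _ Kx; lra.
Qed.

Definition near_seq (s : seq R) (d : R) : set R :=
  [set x | has (fun r => `|x - r| < d) s].

Lemma lebesgue_measure_near_seq (s : seq R) (d : R) : 0 < d ->
  measurable (near_seq s d : set RT) /\
  (leb (near_seq s d) <= ((size s)%:R * (2 * d))%:E)%E.
Proof.
move=> d0; elim: s => [|r s [mS IH]].
  rewrite (_ : near_seq _ _ = set0); last by apply/seteqP; split.
  by rewrite measure0 mul0r; split.
rewrite (_ : near_seq _ _ = ball r d `|` near_seq s d); last first.
  apply/seteqP; split => x; rewrite /near_seq /ball/= distrC.
    by case/orP; [left|right].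
  by case=> ->//; rewrite orbT.
have mB : measurable (ball r d : set RT) by exact: measurable_ball.
split; first exact: measurableU.
apply: (le_trans (measureU2 (leb : {measure set RT -> \bar R}) mB mS)).
rewrite /= (lebesgue_measure_ball _ (ltW d0)) addeC -natr1 mulrDl mul1r.
by rewrite -(mulr_natl d 2) [X in (_ <= X)%E]EFinD; exact: leeD2r.
Qed.

(** The mass of [[x - h, x + h]] is a difference of two nondecreasing functions of [x]. *)
Lemma measurable_measure_ball_le (mu : {measure set RT -> \bar R}) (h : R) (c : \bar R) :
  (mu setT < +oo)%E -> 0 <= h ->
  measurable ([set x | (mu `[(x - h)%R, (x + h)%R]%classic <= c)%E] : set RT).
Proof.
move=> muT h0.
have fin (A : set RT) : measurable A -> mu A \is a fin_num.
  move=> mA; rewrite ge0_fin_numE//; apply: le_lt_trans muT.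
  by apply: le_measure; rewrite ?inE.
have mo (A B : set RT) : measurable A -> measurable B -> A `<=` B -> fine (mu A) <= fine (mu B).
  by move=> mA mB AB; apply: fine_le; rewrite ?fin//; apply: le_measure; rewrite ?inE.
pose F (x : R) := fine (mu `]-oo, x + h]%classic).
pose G (x : R) := fine (mu `]-oo, x - h[%classic).
have mF : measurable_fun setT (F : RT -> RT).
  apply: nondecreasing_measurable => // x y xy; apply: mo; try exact: measurable_itv.
  by move=> t /=; rewrite !in_itv/= => /le_trans; apply; rewrite lerD2r.
have mG : measurable_fun setT (G : RT -> RT).
  apply: nondecreasing_measurable => // x y xy; apply: mo; try exact: measurable_itv.
  by move=> t /=; rewrite !in_itv/= => /lt_le_trans; apply; rewrite lerD2r.
have muE x : mu `[x - h, x + h]%classic = (F x - G x)%:E.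
  have -> : F x = fine (mu `]-oo, (x - h)%R[%classic + mu `[(x - h)%R, (x + h)%R]%classic)%E.
    rewrite /F -measureU//; try exact: measurable_itv.
      congr (fine (mu _)); apply/seteqP; split => t /=; rewrite !in_itv/=.
        by move=> tx; case: (ltP t (x - h)) => ?; [left|right].
      by case=> [?|/andP[]//]; lra.
    apply/seteqP; split => t //=; rewrite !in_itv/= => -[tx /andP[xt _]].
    by have := lt_le_trans tx xt; rewrite ltxx.
  rewrite fineD ?fin//; try exact: measurable_itv.
  rewrite /G addrAC subrr add0r fineK// fin//; exact: measurable_itv.
under eq_set do rewrite muE.
have mFG : measurable_fun setT (fun x : RT => (F x - G x)%:E).
  by apply/measurable_EFinP; exact: measurable_funB.
by rewrite -[X in measurable X]setTI; apply: measurable_lee => //; exact: measurable_cst.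
Qed.

End Bounds.

(** * Consequences of a small norm for one monic polynomial *)

Section LowerBound.
Context {R : realType}.
Notation RT := (measurableTypeR R).
Notation leb := (@lebesgue_measure R).
Variables (mu w : {measure set RT -> \bar R}) (K E : set R) (D A Y : R).
Hypotheses (mK : measurable (K : set RT)) (mE : measurable (E : set RT)).
Hypotheses (muK : mu (~` K) = 0%E) (muT : (mu setT < +oo)%E).
Hypotheses (D0 : 0 <= D) (KD : forall x, K x -> `|x| <= D).
Hypotheses (wT : w setT = 1%E) (wE : w (~` E) = 0%E) (A0 : 0 <= A).
Hypothesis wleb : forall B, measurable B -> (w B <= A%:E * leb B)%E.
Let C := ln (2 * D + 1).
Hypothesis wint : forall z, `|z| <= D -> (\int[w]_y pkernel C z y <= Y%:E)%E.

Definition thin_set (m : nat) (eta : R) : set R :=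
  [set x | E x /\ (mu `[(x - m%:R^-1)%R, (x + m%:R^-1)%R]%classic
                   <= (expR (- (m%:R * eta)%R))%:E)%E].

Lemma one_sub_ge_expR (t : R) : 0 <= t -> t <= 2^-1 -> expR (- (2 * t)) <= 1 - t.
Proof.
move=> t0 t1; rewrite expRN -[leRHS]invrK lef_pV2 ?posrE ?expR_gt0 ?invr_gt0//; last lra.
apply: le_trans (expR_ge1Dx _).
rewrite -[leLHS]mul1r ler_pdivrMr; last lra.
have := mulr_ge0 t0 (_ : 0 <= 1 - 2 * t); lra.
Qed.

(* Moving from [x] to a point of its [1/m]-neighbourhood shrinks each factor
   [`|x - r|] by at most [1 - 1/T], so the whole neighbourhood contributes to the
   integral. *)
Lemma log_roots_le (P : {poly R}) (s : seq R) (m : nat) (T eta U x : R) :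
  (0 < m)%N -> 2 <= T ->
  (forall r, r \in s -> `|r| <= D) ->
  (forall x, `|x| <= D -> \prod_(r <- s) `|x - r| <= `|P.[x]|) ->
  (\int[mu]_x ((`|P.[x]| ^+ 2)%R)%:E < (expR (- (2 * (size s)%:R * U)))%:E)%E ->
  E x -> ~ thin_set m eta x -> ~ near_seq s (T / m%:R) x ->
  (forall r, r \in s -> 0 < `|x - r|) /\
  \sum_(r <- s) ln `|x - r| <=
    - ((size s)%:R * U) + m%:R * eta / 2 + 2 * (size s)%:R / T.
Proof.
move=> m0 T2 sD sP intP Ex nthin nnear.
have m0' : 0 < m%:R :> R by rewrite ltr0n.
have T0 : 0 < T by lra.
have far r : r \in s -> T / m%:R <= `|x - r|.
  move=> rs; rewrite leNgt; apply/negP => h; apply: nnear.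
  by rewrite /near_seq/=; apply/hasP; exists r.
have far0 r : r \in s -> 0 < `|x - r|.
  by move=> /far; apply: lt_le_trans; rewrite divr_gt0.
split=> //; set L := \sum_(r <- s) _; set n := (size s)%:R.
set J : set R := `[x - m%:R^-1, x + m%:R^-1]%classic.
have mJ : measurable (J : set RT) by exact: measurable_itv.
have muJ : ((expR (- (m%:R * eta)))%:E < mu J)%E.
  by rewrite ltNge; apply/negP => h; apply: nthin; split.
have PJ y : J y -> K y -> expR (L - 2 * n / T) <= `|P.[y]|.
  move=> Jy Ky; apply: le_trans (sP _ (KD Ky)).
  have -> : L - 2 * n / T = \sum_(r <- s) (ln `|x - r| - 2 / T).
    by rewrite sumrB sumr_const_seq -/L -/n mulrCA mulrA.
  rewrite expR_sum big_seq [leRHS]big_seq; apply: ler_prod => r rs.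
  rewrite expR_ge0/= expRD lnK ?posrE ?far0//.
  apply: (@le_trans _ _ (`|x - r| * (1 - T^-1))).
    rewrite ler_wpM2l//; apply: one_sub_ge_expR; first by rewrite invr_ge0 ltW.
    by rewrite lef_pV2 ?posrE.
  have xy : `|x - y| <= m%:R^-1.
    move: Jy; rewrite /J/= in_itv/= => /andP[? ?].
    by rewrite ler_norml; apply/andP; split; lra.
  have := ler_normD (x - y) (y - r); rewrite subrKA => tri.
  have : m%:R^-1 <= `|x - r| / T by rewrite ler_pdivlMr// mulrC far.
  lra.
have mJK : measurable ((J `&` K) : set RT) by exact: measurableI.
(* The bound [PJ] holds on [K] only, and [mu] charges nothing else. *)
have muJK : (mu J <= mu (J `&` K))%E.
  rewrite -[leRHS]adde0 -muK.
  apply: le_trans (measureU2 mu mJK (measurableC mK)).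
  apply: le_measure; rewrite ?inE//.
    by apply: measurableU => //; exact: measurableC.
  by move=> y Jy; have [Ky|nKy] := pselect (K y); [left|right].
set c := expR (L - 2 * n / T) ^+ 2.
have c0 : 0 < c by rewrite exprn_gt0// expR_gt0.
have : (c%:E * mu J <= \int[mu]_x ((`|P.[x]| ^+ 2)%R)%:E)%E.
  apply: (@le_trans _ _ (c%:E * mu (J `&` K))%E).
    by apply: lee_wpmul2l => //; rewrite lee_fin ltW.
  apply: (@le_trans _ _ (\int[mu]_(x in J `&` K) ((`|P.[x]| ^+ 2)%R)%:E)%E).
    rewrite -integral_cst//; apply: ge0_le_integral => //.
    - by move=> y _; rewrite lee_fin ltW.
    - by apply: measurable_funTS; exact: measurable_horner_sqr.
    - move=> y [Jy Ky]; rewrite lee_fin ler_pXn2r ?nnegrE ?expR_ge0//; exact: PJ.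
  apply: ge0_subset_integral => //; exact: measurable_horner_sqr.
move=> /le_lt_trans/(_ intP) H.
have {}H : (c%:E * (expR (- (m%:R * eta)))%:E < (expR (- (2 * n * U)))%:E)%E.
  by apply: le_lt_trans H; apply: lee_wpmul2l; [rewrite lee_fin ltW|exact: ltW].
move: H; rewrite -EFinM lte_fin /c -expRM_natl -expRD ltr_expR => H.
by move: H; lra.
Qed.

(** The sum [f] of the shifted kernels at the roots is at least [a] on [E] away from the thin set
    and the roots. The density bound on [w] makes the exceptional mass small, while [f] has
    [w]-integral at most [n%:R * Y]; a Markov-type estimate concludes. *)
Lemma small_monic_integral_bound (P : {poly R}) (n m : nat) (T eta U beta : R) :
  (0 < m)%N -> 2 <= T -> P \is monic -> size P = n.+1 ->
  (\int[mu]_x ((`|P.[x]| ^+ 2)%R)%:E < (expR (- (2 * n%:R * U)))%:E)%E ->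
  (leb (thin_set m eta) <= beta%:E)%E ->
  let a := n%:R * U - m%:R * eta / 2 - 2 * n%:R / T + n%:R * C in
  0 <= a -> a * (1 - A * (beta + n%:R * (2 * (T / m%:R)))) <= n%:R * Y.
Proof.
move=> m0 T2 mP sP intP thin a a0.
have m0' : 0 < m%:R :> R by rewrite ltr0n.
have [s [ss sD sPx]] := monic_ge_real_rooted D0 mP sP.
rewrite -ss in intP.
pose f y : \bar R := (\sum_(r <- s) pkernel C r y)%E.
have f0 y : (0 <= f y)%E by apply: sume_ge0 => r _; exact: pkernel_ge0.
have mf : measurable_fun setT (f : RT -> \bar R).
  by apply: emeasurable_sum => r; exact: measurable_pkernel.
pose G : set R := [set y | (a%:E <= f y)%E].
have mG : measurable (G : set RT).
  by rewrite -[G]setTI; apply: measurable_lee => //; exact: measurable_cst.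
have GE x : E x -> ~ thin_set m eta x -> ~ near_seq s (T / m%:R) x -> G x.
  move=> Ex nthin nnear.
  have [far0 Lle] := log_roots_le m0 T2 sD sPx intP Ex nthin nnear.
  apply: (@le_trans _ _ (\sum_(r <- s) (- ln `|x - r| + C)%:E)%E).
    rewrite sumEFin lee_fin big_split/= sumr_const_seq sumrN ss /a.
    by move: Lle; rewrite ss; lra.
  rewrite big_seq [leRHS]big_seq; apply: lee_sum => r rs.
  have := logkernel_le_pkernel C r x; rewrite leeBrDr//; apply: le_trans.
  rewrite /logkernel; case: eqVneq => [rx|_]; first by rewrite addye// leey.
  by rewrite -EFinD lee_fin (distrC r x).
pose kap := A * (beta + n%:R * (2 * (T / m%:R))).
have mthin : measurable (thin_set m eta : set RT).
  apply: (@measurableI _ RT E) => //; apply: measurable_measure_ball_le => //.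
have Tm0 : 0 < T / m%:R by rewrite divr_gt0//; lra.
have [mnear nearle] := lebesgue_measure_near_seq s Tm0.
have wnG : (w (~` G) <= kap%:E)%E.
  have mGE : measurable ((~` G `&` E) : set RT) by apply: measurableI => //; exact: measurableC.
  apply: (@le_trans _ _ (w (~` G `&` E) + w (~` E))%E).
    apply: le_trans (measureU2 w mGE (measurableC mE)).
    apply: le_measure; rewrite ?inE.
    - exact: measurableC.
    - by apply: measurableU => //; exact: measurableC.
    - by move=> y nGy; have [Ey|nEy] := pselect (E y); [left|right].
  rewrite wE adde0; apply: (le_trans (wleb mGE)).
  rewrite /kap EFinM; apply: lee_wpmul2l; first by rewrite lee_fin.
  apply: (@le_trans _ _ (leb (thin_set m eta) + leb (near_seq s (T / m%:R)))%E).
    apply: le_trans (measureU2 (leb : {measure set RT -> \bar R}) mthin mnear).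
    apply: le_measure; rewrite ?inE//; first exact: measurableU.
    move=> y [nGy Ey]; apply: contrapT => /not_orP[h1 h2]; apply: nGy; exact: GE.
  by rewrite EFinD; apply: leeD => //; rewrite -ss.
have wG : ((1 - kap)%:E <= w G)%E.
  have wGC : (w G + w (~` G) = 1)%E.
    rewrite -measureU ?setUv ?setICr//; exact: measurableC.
  rewrite EFinB leeBlDr// -wGC; exact: leeD2l.
have intf : (\int[w]_y f y <= (n%:R * Y)%:E)%E.
  rewrite /f ge0_integral_sum//; last 2 first.
  - by move=> r; exact: measurable_pkernel.
  - by move=> r y _; exact: pkernel_ge0.
  rewrite -ss -sumr_const_seq -sumEFin big_seq [leRHS]big_seq.
  by apply: lee_sum => r rs; apply: wint; exact: sD.
rewrite -lee_fin EFinM; apply: le_trans intf.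
apply: (@le_trans _ _ (a%:E * w G)%E).
  by apply: lee_wpmul2l => //; rewrite lee_fin.
rewrite -integral_cst//.
apply: (@le_trans _ _ (\int[w]_(y in G) f y)%E).
  apply: ge0_le_integral => //.
  exact: measurable_funTS.
exact: ge0_subset_integral.
Qed.

End LowerBound.

(** * Choice of parameters and the limit of the roots *)

Section Regularity.
Context {R : realType}.
Notation RT := (measurableTypeR R).
Notation leb := (@lebesgue_measure R).

(** [rho0] is at most every length [b i - a i]; the segment around [e] starts at [e] or, if that
    would pass [b i], ends at [b i]. *)
Lemma union_itv_prop (l : nat) (a b : nat -> R) (E : set R) :
  (0 < l)%N -> (forall i, (i < l)%N -> a i < b i) ->
  E = \bigcup_(i in [set i | (i < l)%N]) `[a i, b i]%classic ->
  [/\ measurable (E : set RT), E !=set0 & exists2 rho0, 0 < rho0 &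
   forall rho e : R, 0 < rho -> rho <= rho0 -> E e ->
     exists2 c, `[c, c + rho]%classic `<=` E & c <= e <= c + rho].
Proof.
move=> l0 ab ->; split.
- by apply: bigcup_measurable => i _; exact: measurable_itv.
- by exists (a 0%N), 0%N => //=; rewrite in_itv/= lexx ltW// ab.
have [rho0 rho00 Hrho] : exists2 rho0, 0 < rho0 & forall i, (i < l)%N -> rho0 <= b i - a i.
  clear l0; elim: l ab => [|l IH] ab; first by exists 1.
  have [i il|r r0 Hr] := IH; first by apply: ab; rewrite ltnW.
  exists (Num.min r (b l - a l)); first by rewrite lt_min r0 subr_gt0 ab.
  move=> i; rewrite ltnS leq_eqVlt => /orP[/eqP->|/Hr ri].
    by rewrite ge_min lexx orbT.
  by rewrite ge_min ri.
exists rho0 => // rho e rho_gt0 rhole [i il /=]; rewrite in_itv/= => /andP[ae eb].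
have rb := le_trans rhole (Hrho i il).
have [h|h] := leP (e + rho) (b i).
  exists e; last by rewrite lexx lerDl ltW.
  by move=> y /=; rewrite in_itv/= => /andP[? ?]; exists i => //=; rewrite in_itv/=; lra.
exists (b i - rho); last by apply/andP; split; lra.
by move=> y /=; rewrite in_itv/= => /andP[? ?]; exists i => //=; rewrite in_itv/=; lra.
Qed.

Lemma root_of_sqrt_bounds (n : nat) (q u v : R) : (0 < n)%N ->
  expR (- (2 * n%:R * u)) <= q -> q <= expR (- (2 * n%:R * v)) ->
  expR (- u) <= powR (Num.sqrt q) n%:R^-1 <= expR (- v).
Proof.
move=> n0 uq qv; have n0' : 0 < n%:R :> R by rewrite ltr0n.
have key (t : R) : expR (- t) = powR (Num.sqrt (expR (- (2 * n%:R * t)))) n%:R^-1.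
  have -> : expR (- (2 * n%:R * t)) = expR (- (n%:R * t)) ^+ 2.
    by rewrite -expRM_natl; congr expR; ring.
  rewrite sqrtr_sqr ger0_norm ?expR_ge0// -expRM; congr expR.
  by field; rewrite gt_eqF.
have nV : 0 <= n%:R^-1 :> R by rewrite invr_ge0 ltW.
by rewrite (key u) (key v); apply/andP; split;
  apply: ge0_ler_powR; rewrite ?nnegrE ?sqrtr_ge0// ler_wsqrtr.
Qed.

(** Take [U = V + 6 * eps] and [m = n * L] in [small_monic_integral_bound]. With [eta = 2 * eps / L]
    and [T = 2 / eps], thinness and displacement each cost [n * eps], leaving
    [a = n * (Y + 3 * eps)]. An exceptional mass at most [kap] then gives [Y + 2 * eps <= Y]. *)
Lemma inf_monic_integral_ge (mu : {measure set RT -> \bar R}) (K E : set R) (D V eps A : R)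
    (w : {measure set RT -> \bar R}) :
  measurable (K : set RT) -> measurable (E : set RT) ->
  mu (~` K) = 0%E -> (mu setT < +oo)%E -> 0 <= D ->
  (forall x, K x -> `|x| <= D) ->
  w setT = 1%E -> w (~` E) = 0%E -> 0 < A ->
  (forall B, measurable B -> (w B <= A%:E * leb B)%E) ->
  0 < eps -> eps <= 1 ->
  (forall z, `|z| <= D -> (\int[w]_y pkernel (ln (2 * D + 1)) z y <=
     (V + eps + ln (2 * D + 1))%:E)%E) ->
  (forall eta : R, 0 < eta -> (fun m => leb (thin_set mu E m eta)) @ \oo --> 0%E) ->
  exists n0, forall n, (n0 <= n)%N ->
    ((expR (- (2 * n%:R * (V + 6 * eps))))%:E <=
     ereal_inf [set (\int[mu]_x ((`|P.[x]| ^+ 2)%R)%:E)%E | P in @monic_deg R n])%E.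
Proof.
move=> mK mE muK muT D0 KD wT wE A0 wleb eps0 eps1 wint thin.
set C := ln (2 * D + 1) in wint *; set Y := V + eps + C in wint *.
have Y0 : 0 <= Y.
  have h : `|0 : R| <= D by rewrite normr0.
  rewrite -lee_fin; apply: le_trans (wint 0 h).
  by apply: integral_ge0 => y _; exact: pkernel_ge0.
pose kap := eps / (Y + 3 * eps).
have kap0 : 0 < kap by rewrite divr_gt0//; lra.
(* Half of [kap] is reserved for the thin set, the other half, through [L], for the neighbourhoods
   of the roots. *)
pose beta := kap / (2 * A).
have beta0 : 0 < beta by rewrite divr_gt0// mulr_gt0.
pose T := 2 / eps.
have T2 : 2 <= T by rewrite /T ler_pdivlMr//; lra.
pose L := (Num.bound (4 * T * A / kap)).+1.
have L0 : 0 < L%:R :> R by rewrite ltr0n.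
have HL : A * (2 * T / L%:R) <= kap / 2.
  have : 4 * T * A / kap <= L%:R.
    apply: (le_trans (ltW (archi_boundP _))); last by rewrite ler_nat.
    apply: divr_ge0 (ltW kap0); apply: mulr_ge0 (ltW A0).
    by move: T2; lra.
  rewrite ler_pdivrMr// => h; rewrite mulrA ler_pdivrMr//.
  by clearbody T kap; move: h; set LR := L%:R; clearbody LR; lra.
pose eta := 2 * eps / L%:R.
have eta0 : 0 < eta by rewrite divr_gt0//; lra.
have [m0 _ Hm0] : \forall m \near \oo, (leb (thin_set mu E m eta) < beta%:E)%E.
  apply: (thin eta eta0 [set x | (x < beta%:E)%E]).
  by apply: open_nbhs_nbhs; split; [exact: open_ereal_lt_ereal|rewrite /= lte_fin].
exists m0.+1 => n nm0; have n0 : (0 < n)%N by exact: leq_trans nm0.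
have n0' : 0 < n%:R :> R by rewrite ltr0n.
apply: le_ereal_inf_tmp => _ [P [mP sP] <-].
rewrite leNgt; apply/negP => small.
have m00 : (0 < n * L)%N by rewrite muln_gt0 n0.
have thinle : (leb (thin_set mu E (n * L)%N eta) <= beta%:E)%E.
  by apply/ltW/Hm0 => /=; rewrite (leq_trans (ltnW nm0))// leq_pmulr.
have := small_monic_integral_bound mK mE muK muT D0 KD wT wE (ltW A0) wleb wint
  m00 T2 mP sP small thinle.
have -> : n%:R * (V + 6 * eps) - (n * L)%:R * eta / 2 - 2 * n%:R / T + n%:R * C =
    n%:R * (Y + 3 * eps).
  rewrite /eta /T /Y natrM; field.
  by rewrite !gt_eqF.
have -> : n%:R * (2 * (T / (n * L)%:R)) = 2 * T / L%:R.
  by rewrite natrM; field; rewrite !gt_eqF.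
have nY : 0 <= n%:R * (Y + 3 * eps) by rewrite mulr_ge0//; lra.
move=> /(_ nY); rewrite -mulrA ler_pM2l// => H.
have Hk : A * (beta + 2 * T / L%:R) <= kap.
  rewrite mulrDr (_ : A * beta = kap / 2); first lra.
  by rewrite /beta; field; rewrite gt_eqF.
have : (Y + 3 * eps) * (1 - kap) <= Y.
  apply: le_trans H; rewrite ler_wpM2l//; lra.
have -> : (Y + 3 * eps) * (1 - kap) = Y + 2 * eps.
  by rewrite /kap; field; rewrite gt_eqF//; lra.
lra.
Qed.

End Regularity.

Unset Implicit Arguments.

Theorem theorem1p11 (R : realType) (l : nat) (a b : nat -> R) (E : set R)
  (mu : {measure set (measurableTypeR R) -> \bar R}) :
  (0 < l)%N ->
  (forall i, (i < l)%N -> a i < b i) ->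
  (forall i j, (i < l)%N -> (j < l)%N -> i != j ->
     `[a i, b i]%classic `&` `[a j, b j]%classic = set0) ->
  E = \bigcup_(i in [set i | (i < l)%N]) `[a i, b i]%classic ->
  (mu setT < +oo)%E ->
  compact (msupp mu) ->
  ess_supp mu = E ->
  (forall eta : R, 0 < eta ->
     (fun m : nat => lebesgue_measure
        [set x | E x /\ (mu `[(x - m%:R^-1)%R, (x + m%:R^-1)%R]%classic <= (expR (- (m%:R * eta)%R))%:E)%E])
     @ \oo --> 0%E) ->
  regular_measure mu.
Proof.
move=> l0 ab _ EU muT cK essE thin.
have [mE E0 [rho0 rho00 Eitv]] := union_itv_prop l0 ab EU.
have mK : measurable (msupp mu : set (measurableTypeR R)) by exact: compact_measurable.
have EK : E `<=` msupp mu by rewrite -essE; exact: ess_supp_subset.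
have muK := msupp_compl_null mK.
have [D D0 KD] : exists2 D : R, 0 <= D & forall x, msupp mu x -> `|x| <= D.
  have [M [Mr HM]] := compact_bounded cK.
  exists (`|M| + 1); first by rewrite addr_ge0.
  by apply: HM; have := ler_norm M; lra.
have Kfin d : 0 < d -> exists Q : seq R, forall x, msupp mu x ->
    x \in Q \/ exists2 e, E e & `|x - e| < d.
  by move=> d0; rewrite -essE; exact: msupp_near_ess_supp.
have [V VE H] := equilibrium_approximation cK KD EK E0 rho00 Eitv Kfin.
have capE : log_capacity (msupp mu) = expR (- V) by rewrite /log_capacity VE.
have bounds eps : 0 < eps -> eps <= 1 -> exists N, forall n, (N <= n)%N ->
    expR (- (V + 6 * eps)) <= powR (min_monic_L2 mu n) n%:R^-1 <= expR (- (V - 2 * eps)).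
  move=> eps0 eps1; have [A [n1 [A0 n10 Hn]]] := H _ eps0.
  (* One measure [w], taken at [n1], serves the lower bound in every degree; only the points [s]
     vary with [n]. *)
  have [_ [_ [w [_ [wT wE wleb wint]]]]] := Hn n1 (leqnn _).
  have wE' : w (~` E) = 0%E by apply: wE => y Ey; exact.
  have [n2 Hn2] := inf_monic_integral_ge mK mE muK muT D0 KD wT wE' A0 wleb eps0 eps1 wint thin.
  pose M := fine (mu setT).
  have ME : mu setT = M%:E by rewrite fineK// ge0_fin_numE.
  (* For such [n] the total mass is at most [expR (2 * n * eps)], which costs a second [eps] in the
     upper bound. *)
  pose n3 := Num.bound (`|M| / (2 * eps)).
  exists (maxn n1 (maxn n2 n3)) => n; rewrite !geq_max => /and3P[nn1 nn2 nn3].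
  have n0 : (0 < n)%N by exact: leq_trans nn1.
  have [r [s [_ [[r0 sn _ HS] _]]]] := Hn n nn1.
  rewrite -sn in HS.
  have := monic_integral_le mK muK r0 HS; rewrite sn ME -EFinM.
  have := Hn2 n nn2; rewrite /min_monic_L2.
  set q := ereal_inf _ => qlo qhi.
  have qfin : q \is a fin_num.
    by rewrite fin_numE; case: (q) qlo qhi.
  rewrite -(fineK qfin) !lee_fin in qlo qhi.
  apply: root_of_sqrt_bounds => //; apply: (le_trans qhi).
  have -> : expR (- (2 * n%:R * (V - 2 * eps))) =
      expR (- (2 * n%:R * (V - eps))) * expR (2 * n%:R * eps).
    by rewrite -expRD; congr expR; ring.
  rewrite ler_pM2l ?expR_gt0//; apply: le_trans (expR_ge1Dx _).
  have : `|M| / (2 * eps) <= n%:R.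
    apply: (le_trans (ltW (archi_boundP _))); last by rewrite ler_nat.
    by rewrite divr_ge0//; lra.
  rewrite ler_pdivrMr; last lra.
  have := ler_norm M; lra.
rewrite /regular_measure capE; apply/cvgrPdist_lt => e e0.
have [d /= d0 Hd] : exists2 d : R, 0 < d &
    forall t : R, `|- V - t| < d -> `|expR (- V) - expR t| < e.
  have /cvgrPdist_lt/(_ e e0) := @continuous_expR R (- V).
  by rewrite -nbhs_ballE => -[d d0 Hd]; exists d => // t /Hd.
(* The larger deviation from [- V] is [6 * eps], and [7 * eps <= d] makes it strictly less than
   [d]. *)
pose eps := Num.min 1 (d / 7).
have eps0 : 0 < eps by rewrite lt_min ltr01/= divr_gt0.
have eps1 : eps <= 1 by rewrite ge_min lexx.
have epsd : 7 * eps <= d.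
  have : eps <= d / 7 by rewrite ge_min lexx orbT.
  lra.
have [N HN] := bounds eps eps0 eps1.
exists N => // n /= Nn; have /andP[lo hi] := HN n Nn.
have /Hd : `|- V - - (V + 6 * eps)| < d by rewrite ltr_norml; lra.
have /Hd : `|- V - - (V - 2 * eps)| < d by rewrite ltr_norml; lra.
rewrite !ltr_norml => /andP[h1 h2] /andP[h3 h4]; lra.
Qed.
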